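(* Let $k\geq 2$ and $t\geq 1$ be integers, and let $G$ be a $t$-connected graph of order $n$. If $n \ge \max\{6k+6t-1,\ k^2+\frac{3}{2}kt+\frac{1}{2}t^2+\frac{1}{2}t+1\}$ and $$\rho(G) \ge \rho\big(K_t \nabla (K_{n-k-2t+1} \cup (k+t-1)K_1)\big),$$ then $G$ has a spanning $k$-ended tree unless $G \cong K_t \nabla (K_{n-k-2t+1} \cup (k+t-1)K_1)$.
   Context: All graphs are finite, simple and undirected. $\rho(G)$ denotes the spectral radius of $G$, i.e., the largest eigenvalue of its adjacency matrix. A graph is $t$-connected if it has more than $t$ vertices and remains connected whenever fewer than $t$ vertices are removed. For an integer $k\ge 2$, a spanning $k$-ended tree of a connected graph is a spanning tree with at most $k$ leaves (vertices of degree one). $K_m$ is the complete graph on $m$ vertices, $mK_1$ is the empty graph on $m$ vertices, $\cup$ denotes disjoint union, and $G_1\nabla G_2$ (the join) is obtained from $G_1\cup G_2$ by adding all edges between $G_1$ and $G_2$. *)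

(* Defs.v *)
From HB Require Import structures.
From mathcomp Require Import all_boot all_order all_algebra.
From mathcomp Require Import classical_sets reals.
Set Implicit Arguments.
Unset Strict Implicit.
Unset Printing Implicit Defensive.
Import Order.TTheory GRing.Theory Num.Theory.

Record sgraph (T : finType) := SGraph {
  edge :> rel T;
  edge_sym : symmetric edge;
  edge_irrefl : irreflexive edge }.

Section Notions.
Variable T : finType.
Implicit Types G H : sgraph T.

Definition degree G (x : T) : nat := #|[set y | G x y]|.

Definition connected G : Prop := 0 < #|T| /\ forall x y : T, connect G x y.

(* Duplicate-free closed walks with at most two vertices are not cycles:
   [:: x; y] only traverses the edge xy back and forth. *)
Definition acyclic G : Prop := forall p : seq T, ucycle G p -> size p <= 2.

Definition is_tree G : Prop := connected G /\ acyclic G.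

Definition leaves G : {set T} := [set x | degree G x == 1].

Definition spanning_tree G H : Prop := subrel H G /\ is_tree H.

Definition has_spanning_ended_tree (k : nat) G : Prop :=
  exists2 H : sgraph T, spanning_tree G H & #|leaves H| <= k.

End Notions.

Section Constructions.

Definition induced_rel (T : finType) (G : sgraph T) (A : {set T}) :
    rel {x : T | x \in A} := fun x y => G (val x) (val y).

Lemma induced_sym T G A : symmetric (@induced_rel T G A).
Proof. by move=> x y; rewrite /induced_rel edge_sym. Qed.

Lemma induced_irrefl T G A : irreflexive (@induced_rel T G A).
Proof. by move=> x; rewrite /induced_rel edge_irrefl. Qed.

Definition induced T G A := SGraph (@induced_sym T G A) (@induced_irrefl T G A).

Definition complete_rel (m : nat) : rel 'I_m := fun i j => i != j.

Lemma complete_sym m : symmetric (@complete_rel m).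
Proof. by move=> i j; rewrite /complete_rel eq_sym. Qed.

Lemma complete_irrefl m : irreflexive (@complete_rel m).
Proof. by move=> i; rewrite /complete_rel eqxx. Qed.

Definition complete m := SGraph (@complete_sym m) (@complete_irrefl m).

Definition empty_rel (m : nat) : rel 'I_m := fun _ _ => false.

Lemma empty_sym m : symmetric (@empty_rel m). Proof. by []. Qed.

Lemma empty_irrefl m : irreflexive (@empty_rel m). Proof. by []. Qed.

Definition empty m := SGraph (@empty_sym m) (@empty_irrefl m).

(* The Boolean b tells whether vertices of different summands are adjacent. *)
Definition sum_rel (b : bool) (T U : finType) (G : sgraph T) (H : sgraph U) :
    rel (T + U)%type := fun x y =>
  match x, y with
  | inl x1, inl y1 => G x1 y1
  | inr x2, inr y2 => H x2 y2
  | _, _ => b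
  end.

Lemma sum_rel_sym b T U G H : symmetric (@sum_rel b T U G H).
Proof. by move=> [x|x] [y|y] //=; rewrite edge_sym. Qed.

Lemma sum_rel_irrefl b T U G H : irreflexive (@sum_rel b T U G H).
Proof. by move=> [x|x] /=; rewrite edge_irrefl. Qed.

Definition disjoint_union T U G H :=
  SGraph (@sum_rel_sym false T U G H) (@sum_rel_irrefl false T U G H).

Definition join T U G H :=
  SGraph (@sum_rel_sym true T U G H) (@sum_rel_irrefl true T U G H).

End Constructions.

Definition t_connected (t : nat) (T : finType) (G : sgraph T) : Prop :=
  t < #|T| /\ forall S : {set T}, #|S| < t -> connected (induced G (~: S)).

Definition isomorphic (T U : finType) (G : sgraph T) (H : sgraph U) : Prop :=
  exists2 f : T -> U, bijective f & forall x y, H (f x) (f y) = G x y.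

Definition adjacency (R : realType) (T : finType) (G : sgraph T) : 'M[R]_#|T| :=
  \matrix_(i, j) (G (enum_val i) (enum_val j))%:R%R.

(* The spectrum of a symmetric matrix of positive order is finite and
   non-empty, so this supremum is the largest eigenvalue. *)
Definition spectral_radius (R : realType) (T : finType) (G : sgraph T) : R :=
  sup [set a : R | eigenvalue (adjacency R G) a]%classic.

(* Truncated subtraction: the sizes are the intended ones when
   k + 2 * t <= n + 1 and 0 < k + t. *)
Definition extremal (n k t : nat) :=
  join (complete t)
    (disjoint_union (complete (n + 1 - (k + 2 * t))) (empty (k + t - 1))).

(* Main.v *)
Require Import Defs.
From mathcomp Require Import all_boot perm all_order all_algebra.
From mathcomp Require Import zify ring lra.
Set Implicit Arguments.
Unset Strict Implicit.
Unset Printing Implicit Defensive.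

(* Put s = k + t - 1.  The extremal graph has an explicit positive eigenvector
   whose eigenvalue l exceeds n - s - 1, so G has an eigenvalue a >= l; since G
   has minimum degree at least t, the Hong-Shu-Fang inequality
   a (a - t + 1) <= 2 e(G) - (n - 1) t gives 2 e(G) > (n - s)(n - s - 1) + t s.

   It is enough to find a path on n - k + 2 vertices, that is, a cycle on
   n - k + 3 vertices in the cone X over G, which is (t + 1)-connected.  If there
   is none, the Bondy-Chvatal closure of X has none either, and counting edges
   shows that it contains a clique C missing only s vertices.  A longest cycle Z
   contains C.  If Q is a component off Z, the successors of the neighbours of Q
   on Z are independent, so all but one of them are outside C; counting, Q has
   exactly t + 1 neighbours, namely the vertices next on Z to a vertex outside C.
   Exchanging such a vertex with one off the cycle shows that every vertex
   outside C has its neighbours in this same set of t + 1 vertices.  Hence G is a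
   subgraph of the extremal graph, and pairing eigenvectors shows that
   l <= a forces equality. *)

(** * Surgery on cycles *)

Section CycleSurgery.
Variable V : finType.
Implicit Types (e : rel V) (Z r : seq V).

Lemma ucycle_uniq e Z : ucycle e Z -> uniq Z.
Proof. by case/andP. Qed.

Lemma ucycle_cycle e Z : ucycle e Z -> cycle e Z.
Proof. by case/andP. Qed.

Lemma ucycle_rev e Z : symmetric e -> ucycle e Z -> ucycle e (rev Z).
Proof.
move=> sym_e /andP[cZ uZ]; apply/andP; rewrite rev_uniq; split=> //.
by rewrite rev_cycle (eq_cycle (e' := e)) // => x y; rewrite sym_e.
Qed.

Lemma next_cat_cons (p1 p2 : seq V) x y :
  uniq (p1 ++ x :: y :: p2) -> next (p1 ++ x :: y :: p2) x = y.
Proof.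
by move=> uZ; rewrite -(next_rot (size p1) uZ) rot_size_cat /= eqxx.
Qed.

(** The cycle is opened between [x] and its successor, where a detour can then be inserted; [p] is
    empty when [Z] is a single vertex. *)
Lemma ucycle_cut e Z x : ucycle e Z -> x \in Z ->
  exists p, [/\ path e (next Z x) p, last (next Z x) p = x,
     perm_eq (next Z x :: p) Z & next (next Z x :: p) =1 next Z].
Proof.
move=> ucZ Zx; have uZ := ucycle_uniq ucZ.
have [i p def_p] := rot_to Zx.
have ucp : ucycle e (x :: p) by rewrite -def_p rot_ucycle.
have nextE : next Z =1 next (x :: p) by rewrite -def_p => y; rewrite next_rot.
have permZ : perm_eq (x :: p) Z by rewrite -def_p perm_rot.
case: p => [|y p] in def_p ucp nextE permZ *.
  have nx : next Z x = x by rewrite nextE /= eqxx.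
  by exists [::]; rewrite nx; split=> // z; rewrite nextE.
have nx : next Z x = y by rewrite nextE /= eqxx.
exists (rcons p x); rewrite nx; split=> //.
- by case/andP: ucp => /= /andP[].
- by rewrite last_rcons.
- by rewrite (perm_trans _ permZ) // -rcons_cons perm_rcons.
have -> : y :: rcons p x = rot 1 (x :: y :: p) by rewrite rot1_cons.
by move=> z; rewrite next_rot ?nextE // (perm_uniq permZ).
Qed.

Lemma ucycle_split2 e Z a b : ucycle e Z -> a \in Z -> b \in Z -> a != b ->
  exists p q, [/\ path e (next Z a) p, path e (next Z b) q,
    last (next Z a) p = b, last (next Z b) q = a &
    perm_eq ((next Z a :: p) ++ (next Z b :: q)) Z].
Proof.
move=> ucZ Za Zb ab; have [p [path_p last_p permZ nextE]] := ucycle_cut ucZ Za.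
have uyp : uniq (next Z a :: p) by rewrite (perm_uniq permZ) (ucycle_uniq ucZ).
have yb : b \in next Z a :: p by rewrite (perm_mem permZ).
move: (next Z a) => y in path_p last_p permZ nextE yb uyp *.
case/splitPl: p / yb => p1 p2 lastb in path_p last_p permZ nextE uyp *.
case: p2 => [|z p2] in path_p last_p permZ nextE uyp *.
  by rewrite cats0 in last_p; rewrite -last_p lastb eqxx in ab.
have nb : next Z b = z.
  rewrite -nextE -cat_cons lastI lastb cat_rcons next_cat_cons //.
  by rewrite -cat_rcons -lastb -lastI.
move: path_p; rewrite cat_path lastb /= => /and3P[path1 _ path2].
rewrite last_cat /= in last_p.
by exists p1, p2; rewrite nb; split.
Qed.

Lemma path_rev_last e x p y : symmetric e -> path e x p -> e x y ->
  path e (last x p) (rcons (rev (belast x p)) y).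
Proof.
move=> sym_e path_p exy; rewrite rcons_path rev_path; apply/andP; split.
  by rewrite (eq_path (e' := e)) // => u v; rewrite sym_e.
by case: p path_p => //= z p _; rewrite rev_cons last_rcons.
Qed.

(** One arc is run forwards, [r] leads to the end of the other, which is run backwards, and the edge
    between [x] and [y] closes the cycle. *)
Lemma ucycle_cross e p q x y r : symmetric e ->
    path e x p -> path e y q -> e x y -> path e (last x p) (rcons r (last y q)) ->
    uniq (((x :: p) ++ (y :: q)) ++ r) ->
  ucycle e ((x :: p) ++ r ++ rev (y :: q)).
Proof.
move=> sym_e path_p path_q exy path_r uZ; apply/andP; split; last first.
  move: uZ; rewrite (perm_uniq (s2 := (x :: p) ++ r ++ rev (y :: q))) //.
  rewrite -catA perm_cat2l perm_catC perm_cat2l perm_sym.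
  by rewrite perm_rev.
have -> : rev (y :: q) = last y q :: rev (belast y q).
  by rewrite lastI rev_rcons.
rewrite -cat_rcons /= !rcons_cat !cat_path path_p path_r /= last_rcons.
by apply: path_rev_last; rewrite // sym_e.
Qed.

Lemma ucycle_insert e Z x r : ucycle e Z -> x \in Z ->
    path e x (rcons r (next Z x)) -> uniq (Z ++ r) ->
  exists2 Z', ucycle e Z' & size Z' = size Z + size r.
Proof.
move=> ucZ Zx path_r uZr.
have [p [path_p last_p permZ _]] := ucycle_cut ucZ Zx.
exists (next Z x :: p ++ r).
  apply/andP; split; last first.
    by rewrite -cat_cons (perm_uniq (s2 := Z ++ r)) // perm_cat2r.
  by rewrite /= rcons_cat cat_path path_p last_p.
by rewrite -cat_cons size_cat (perm_size permZ).
Qed.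

Lemma ucycle_replace e Z y r : ucycle e Z -> y \in Z -> 1 < size Z ->
    path e (prev Z y) (rcons r (next Z y)) -> uniq (Z ++ r) ->
  exists2 Z', ucycle e Z' & (size Z').+1 = size Z + size r.
Proof.
move=> ucZ Zy Z2 path_r uZr; have uZ := ucycle_uniq ucZ.
have Zx : prev Z y \in Z by rewrite mem_prev.
have [p [path_p last_p permZ nextE]] := ucycle_cut ucZ Zx.
rewrite next_prev // in path_p last_p permZ nextE.
case: p => [|h p] in path_p last_p permZ nextE *.
  by rewrite -(perm_size permZ) in Z2.
have ny : next Z y = h by rewrite -nextE /= eqxx.
exists (h :: p ++ r); last by rewrite -(perm_size permZ) /= size_cat addSn.
apply/andP; split.
  move: path_p last_p => /= /andP[_ path_h] last_h.
  by rewrite ny in path_r; rewrite rcons_cat cat_path path_h last_h.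
move: uZr; rewrite -(perm_uniq (s1 := (y :: h :: p) ++ r)) ?perm_cat2r //.
by case/andP.
Qed.

End CycleSurgery.

(** * Longest cycles in graphs with a large clique *)

Definition nbhd (V : finType) (X : sgraph V) (Q : {set V}) : {set V} :=
  [set y | (y \notin Q) && [exists x in Q, X x y]].

(* Equivalent to [k]-connectivity on at least [k.+1] vertices, but stated so
   that it is visibly stable under adding edges. *)
Definition sep_connected (k : nat) (V : finType) (X : sgraph V) : Prop :=
  forall Q : {set V}, Q != set0 -> Q :|: nbhd X Q != [set: V] ->
    k <= #|nbhd X Q|.

Definition linked (V : finType) (X : sgraph V) (Q : {set V}) : Prop :=
  forall x y, x \in Q -> y \in Q -> exists p,
    [/\ path X x p, last x p = y, uniq (x :: p) & {subset x :: p <= Q}].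

(** The empty sequence and an edge run back and forth count as cycles here, so a longest one always
    exists. *)
Definition longest (V : finType) (X : sgraph V) (Z : seq V) : Prop :=
  ucycle X Z /\ forall Z', ucycle X Z' -> size Z' <= size Z.

(** [Q] is the component of [x] after deletion of [Z]; a neighbour of [Q] off [Z] would belong to
    it. *)
Lemma component_off (V : finType) (X : sgraph V) (Z : seq V) x : x \notin Z ->
  exists Q : {set V}, [/\ x \in Q, forall q, q \in Q -> q \notin Z, linked X Q &
    {subset nbhd X Q <= Z}].
Proof.
move=> Zx; pose e := [rel u v | [&& X u v, u \notin Z & v \notin Z]].
have sym_e : symmetric e by move=> u v; rewrite /= edge_sym [(_ \notin _) && _]andbC.
have csym : connect_sym e := sym_connect_sym sym_e.
exists [set y | connect e x y]; split.
- by rewrite inE connect0.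
- move=> q; rewrite inE => /connectP[p path_p ->] {q}.
  by case/lastP: p path_p => // p y; rewrite rcons_path last_rcons => /andP[_ /and3P[]].
- move=> y z; rewrite !inE => xy xz.
  have : connect e y z by rewrite (connect_trans _ xz) // csym.
  case/connectP=> p path_p ->; case/shortenP: path_p => p' path_p' up _.
  exists p'; split=> //.
    by apply: sub_path path_p' => u v /= /and3P[].
  move=> u pu; rewrite inE (connect_trans xy) //.
  case/splitPl: pu path_p' => p1 p2 <-; rewrite cat_path => /andP[path_p1 _].
  by apply/connectP; exists p1.
move=> y; rewrite !inE => /andP[ny /existsP[q /andP[]]]; rewrite inE => xq qy.
apply: contraR ny => Zy; apply: (connect_trans xq); apply: connect1.
rewrite /= qy Zy andbT.
case/connectP: xq => p path_p ->.
by case/lastP: p path_p => // p z; rewrite rcons_path last_rcons => /andP[_ /and3P[]].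
Qed.

Lemma next_neq (V : eqType) (Z : seq V) x : uniq Z -> 1 < size Z -> x \in Z ->
  next Z x != x.
Proof.
move=> uZ Z2 Zx; have [i p def_p] := rot_to Zx.
rewrite -(next_rot i uZ) def_p.
have : uniq (x :: p) by rewrite -def_p rot_uniq.
case: p def_p => [|y p] def_p.
  by rewrite -(size_rot i) def_p in Z2.
by rewrite /= eqxx inE negb_or eq_sym => /andP[/andP[]].
Qed.

Section OffLongestCycle.
Variables (V : finType) (X : sgraph V) (Z : seq V) (Q : {set V}).
Hypotheses (longZ : longest X Z) (linkQ : linked X Q).
Hypothesis disjQ : forall q, q \in Q -> q \notin Z.

Let ucZ : ucycle X Z. Proof. by case: longZ. Qed.

Lemma link_path a b : a \in nbhd X Q -> b \in nbhd X Q ->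
  exists r, [/\ 0 < size r, path X a (rcons r b), uniq (Z ++ r) & {subset r <= Q}].
Proof.
rewrite !inE => /andP[_ /existsP[x /andP[Qx xa]]] /andP[_ /existsP[y /andP[Qy yb]]].
have [p [path_p last_p up subp]] := linkQ Qx Qy.
exists (x :: p); split=> //.
  by rewrite /= edge_sym xa rcons_path path_p last_p.
rewrite cat_uniq up (ucycle_uniq ucZ) andbT.
by apply/hasPn => z /subp; apply: disjQ.
Qed.

(** Otherwise a detour through [Q] could be inserted between [a] and its successor. *)
Lemma next_nbhdN a : a \in nbhd X Q -> a \in Z -> next Z a \notin nbhd X Q.
Proof.
move=> Na Za; apply/negP => Nb; have [r [r0 path_r ur _]] := link_path Na Nb.
have [Z' ucZ' szZ'] := ucycle_insert ucZ Za path_r ur.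
by case: longZ => _ /(_ _ ucZ'); rewrite szZ'; lia.
Qed.

(** An edge between the two successors, with a detour through [Q] from [b] to [a], would allow
    [ucycle_cross] to build a longer cycle. *)
Lemma next_nbhd_indep a b : a \in nbhd X Q -> b \in nbhd X Q -> a \in Z ->
  b \in Z -> ~~ X (next Z a) (next Z b).
Proof.
move=> Na Nb Za Zb; have [<-|ab] := eqVneq a b; first by rewrite edge_irrefl.
apply/negP => xy.
have [r [r0 path_r ur _]] := link_path Nb Na.
have [p [q [path_p path_q last_p last_q permZ]]] := ucycle_split2 ucZ Za Zb ab.
have ucZ' : ucycle X ((next Z a :: p) ++ r ++ rev (next Z b :: q)).
  apply: ucycle_cross => //; first exact: edge_sym.
    by rewrite last_p last_q.
  by rewrite (perm_uniq (s2 := Z ++ r)) // perm_cat2r.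
case: longZ => _ /(_ _ ucZ'); rewrite -(perm_size permZ) !size_cat size_rev /=; lia.
Qed.

End OffLongestCycle.

Lemma longest_rev (V : finType) (X : sgraph V) (Z : seq V) :
  longest X Z -> longest X (rev Z).
Proof.
case=> ucZ maxZ; split; first by apply: ucycle_rev => //; apply: edge_sym.
by move=> Z' ucZ'; rewrite size_rev maxZ.
Qed.

Lemma card_set_seq (V : finType) (Z : seq V) : uniq Z -> #|[set x in Z]| = size Z.
Proof. by move=> uZ; rewrite cardsE; apply/card_uniqP. Qed.

Lemma ucycle_clique (V : finType) (X : sgraph V) (C : {set V}) :
    {in C &, forall x y, x != y -> X x y} -> 1 < #|C| ->
  ucycle X (enum C).
Proof.
move=> clC C2; apply/andP; split; last exact: enum_uniq.
apply: cycle_from_next => [|x]; first exact: enum_uniq.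
rewrite mem_enum => Cx; apply: clC => //; first by rewrite -mem_enum mem_next mem_enum.
by rewrite eq_sym next_neq ?enum_uniq ?mem_enum // -cardE.
Qed.

(** * A clique missing [s] vertices; here [k] is a connectivity, not a number of leaves *)

Section LargeClique.
Variables (V : finType) (X : sgraph V) (C : {set V}) (s k : nat).
Hypothesis clC : {in C &, forall x y, x != y -> X x y}.
Hypothesis cardC : #|C| + s = #|V|.
Hypotheses (k2 : 2 <= k) (ks : k <= s) (sC : 2 * s < #|C|).
Hypothesis connX : sep_connected k X.
Hypothesis short : forall Z, ucycle X Z -> size Z < #|C| + k.

Let D := ~: C.
Let cardD : #|D| = s.
Proof. by rewrite cardsCs setCK; lia. Qed.

(** A clique vertex off [Z] would fit between any two consecutive clique vertices of [Z]. So [next]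
    would map the clique vertices of [Z] into [D], and [Z] would have at most [2 * s] vertices,
    fewer than the cycle running through [C]. *)
Lemma longest_clique_sub Z : longest X Z -> {subset C <= Z}.
Proof.
move=> [ucZ maxZ] q Cq; apply/negPn/negP => Zq; have uZ := ucycle_uniq ucZ.
have szZ : #|C| <= size Z.
  by rewrite [#|C|]cardE; apply/maxZ/ucycle_clique => //; lia.
have nextD x : x \in Z -> x \in C -> next Z x \in D.
  move=> Zx Cx; rewrite inE; apply/negP => Cn.
  have xq : x != q by apply: contraNneq Zq => <-.
  have qn : q != next Z x by apply: contraNneq Zq => ->; rewrite mem_next.
  have [||Z' ucZ' szZ'] := @ucycle_insert _ X Z x [:: q] ucZ Zx.
  - by rewrite /= !clC.
  - by rewrite cats1 rcons_uniq Zq.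
  by have := maxZ _ ucZ'; rewrite szZ' /=; lia.
pose A := [set x in Z] :&: C.
have cardA : #|A| <= s.
  rewrite -(card_imset _ (can_inj (prev_next uZ))) -cardD subset_leq_card //.
  by apply/subsetP => y /imsetP[x /setIP[]]; rewrite inE => Zx Cx ->; apply: nextD.
have cardB : #|[set x in Z] :\: C| <= s.
  by rewrite -cardD subset_leq_card // setDE subsetIr.
by have := cardsID C [set x in Z]; rewrite -/A card_set_seq //; lia.
Qed.

Definition rim (Z : seq V) : {set V} := [set x in Z] :&: D.
Definition rim_nbrs (Z : seq V) : {set V} :=
  (next Z @: rim Z) :|: (prev Z @: rim Z).

Lemma card_rim Z : longest X Z -> size Z = #|C| + #|rim Z|.
Proof.
move=> longZ; have [/ucycle_uniq uZ _] := longZ.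
have := cardsID C [set x in Z]; rewrite card_set_seq //.
suff -> : [set x in Z] :&: C = C by rewrite /rim setDE => <-.
by apply/setIidPr/subsetP => x /(longest_clique_sub longZ); rewrite inE.
Qed.

(** At least [k] successors of neighbours of [Q] are available, at most one of them in [C]; the
    others lie in the rim, which has fewer than [k] vertices since [Z] is short. Hence all these
    bounds are equalities. *)
Lemma component_next Z (Q : {set V}) : longest X Z -> linked X Q ->
    Q != set0 -> (forall q, q \in Q -> q \notin Z) -> {subset nbhd X Q <= Z} ->
  [/\ #|nbhd X Q| = k, #|rim Z|.+1 = k, nbhd X Q \subset C &
      forall y, y \in rim Z -> prev Z y \in nbhd X Q].
Proof.
move=> longZ linkQ Q0 disjQ subN; have [ucZ _] := longZ; have uZ := ucycle_uniq ucZ.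
set A := nbhd X Q.
have nextN a : a \in A -> next Z a \notin A.
  by move=> Aa; apply: (next_nbhdN longZ linkQ) => //; apply: subN.
have kA : k <= #|A|.
  (* If [Q] and its neighbours were everything, [Z] would consist of neighbours of [Q], against
     [nextN]. *)
  apply: connX => //; apply/negP => /eqP QA.
  have [x Cx] : exists x, x \in C by apply/card_gt0P; lia.
  have Zx := longest_clique_sub longZ Cx.
  have : x \in Q :|: A by rewrite QA inE.
  rewrite inE => /orP[/disjQ|Ax]; first by rewrite Zx.
  have : next Z x \in Q :|: A by rewrite QA inE.
  by rewrite inE (negPf (nextN _ Ax)) orbF => /disjQ; rewrite mem_next Zx.
pose B := next Z @: A.
have cardB : #|B| = #|A| by rewrite card_imset //; apply: can_inj (prev_next uZ).
have BC : #|B :&: C| <= 1.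
  apply: contraT; rewrite -ltnNge => /card_gt1P[x [y []]].
  move=> /setIP[/imsetP[a Aa ->] Cx] /setIP[/imsetP[b Ab ->] Cy] xy.
  have := next_nbhd_indep longZ linkQ disjQ Aa Ab (subN _ Aa) (subN _ Ab).
  by rewrite clC.
have subB : B :\: C \subset rim Z.
  apply/subsetP => y /setDP[/imsetP[a Aa ->] Cy].
  by rewrite !inE mem_next (subN _ Aa) Cy.
have := subset_leq_card subB.
have szZ := card_rim longZ; have := short ucZ; have := cardsID C B.
rewrite szZ cardB => cB ltZ leB.
have cardA : #|A| = k by lia.
have cardZ : #|rim Z|.+1 = k by lia.
have eqB : B :\: C = rim Z by apply/eqP; rewrite eqEcard subB; lia.
have prevA y : y \in rim Z -> prev Z y \in A.
  by rewrite -eqB => /setDP[/imsetP[a Aa ->] _]; rewrite prev_next.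
(* A neighbour of [Q] outside [C] would be on the rim, so its predecessor would be a neighbour too:
   two consecutive ones. *)
split=> //; apply/subsetP => a Aa; apply/negPn/negP => Ca.
have : a \in rim Z by rewrite !inE (subN _ Aa) Ca.
by move/prevA => /nextN; rewrite next_prev // Aa.
Qed.

Lemma rim_rev Z : rim (rev Z) = rim Z.
Proof. by apply/setP => x; rewrite !inE mem_rev. Qed.

(** Using [component_next] on [Z] and on its reverse puts [rim_nbrs Z] inside the neighbourhood.
    Were it smaller, predecessors and successors of the rim would form the same set, so the rim and
    its predecessors would be closed under [next] and cover [Z], too few vertices to contain [C]. *)
Lemma component_nbhd Z (Q : {set V}) : longest X Z -> linked X Q ->
    Q != set0 -> (forall q, q \in Q -> q \notin Z) -> {subset nbhd X Q <= Z} ->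
  [/\ #|nbhd X Q| = k, rim Z != set0, nbhd X Q \subset C & nbhd X Q = rim_nbrs Z].
Proof.
move=> longZ linkQ Q0 disjQ subN; have [ucZ _] := longZ; have uZ := ucycle_uniq ucZ.
have [cardA cardZ subC prevA] := component_next longZ linkQ Q0 disjQ subN.
have [||_ _ _ nextA] := component_next (longest_rev longZ) linkQ Q0.
- by move=> q /disjQ; rewrite mem_rev.
- by move=> q /subN; rewrite mem_rev.
rewrite rim_rev in nextA.
have rim0 : rim Z != set0 by rewrite -card_gt0; lia.
split=> //; apply/esym/eqP; rewrite eqEcard; apply/andP; split.
  apply/subsetP => _ /setUP[] /imsetP[y Dy ->]; last exact: prevA.
  by have := nextA y Dy; rewrite prev_rev.
rewrite cardA -cardZ ltnNge; apply/negP => leU.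
have cardP : #|prev Z @: rim Z| = #|rim Z|.
  by rewrite card_imset //; apply: can_inj (next_prev uZ).
have defP : prev Z @: rim Z = rim_nbrs Z.
  by apply/eqP; rewrite eqEcard subsetUr cardP.
pose W := rim Z :|: prev Z @: rim Z.
have closedW x : x \in W -> next Z x \in W.
  rewrite /W => /setUP[Dx|/imsetP[y Dy ->]]; last by rewrite next_prev // inE Dy.
  by apply/setUP; right; rewrite defP; apply/setUP; left; apply: imset_f.
have [y Dy] := set0Pn _ rim0.
have Zy : y \in Z by move: Dy; rewrite !inE => /andP[].
have CW : C \subset W.
  apply/subsetP => x /(longest_clique_sub longZ) Zx.
  have : fconnect (next Z) y x by rewrite (fconnect_cycle (cycle_next uZ)).
  move/iter_findex => <-; elim: (findex _ _ _) => [|i IH] /=; first by rewrite inE Dy.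
  exact: closedW.
have := subset_leq_card CW; have := (leq_card_setU (rim Z) (prev Z @: rim Z)).1.
by rewrite -/W cardP; lia.
Qed.

Lemma off_nbr Z x y : longest X Z -> x \notin Z -> y \in Z -> X x y ->
  y \in rim_nbrs Z.
Proof.
move=> longZ Zx Zy xy; have [Q [Qx disjQ linkQ subN]] := component_off X Zx.
have Q0 : Q != set0 by apply/set0Pn; exists x.
have [_ _ _ <-] := component_nbhd longZ linkQ Q0 disjQ subN.
rewrite inE; apply/andP; split; first by apply: contraL Zy; apply: disjQ.
by apply/existsP; exists x; rewrite Qx.
Qed.

(** [q] takes the place of [y]. Writing the new cycle as the image under a transposition lets [next]
    and [prev] commute with the exchange. *)
Lemma swap_longest Z y q : longest X Z -> y \in Z -> q \notin Z ->
  X (prev Z y) q -> X q (next Z y) -> longest X [seq tperm y q x | x <- Z].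
Proof.
move=> [ucZ maxZ] Zy Zq pq qn; split; last by move=> Z' /maxZ; rewrite size_map.
have uZ := ucycle_uniq ucZ; have inj_t : injective (tperm y q) by apply: perm_inj.
have umZ : uniq [seq tperm y q x | x <- Z] by rewrite map_inj_uniq.
apply/andP; split=> //; apply: cycle_from_next => // _ /mapP[x Zx ->].
rewrite next_map //.
have xq : x != q by apply: contraNneq Zq => <-.
have nq : next Z x != q by apply: contraNneq Zq => <-; rewrite mem_next.
have Z2 : 1 < size Z.
  case: Z ucZ Zy {maxZ Zq pq qn uZ umZ Zx xq nq} => [|z [|]] //=.
  by rewrite /ucycle /= edge_irrefl.
have [-> | xy] := eqVneq x y.
  have ny : y != next Z y by rewrite eq_sym next_neq.
  have nqy : q != next Z y by apply: contraNneq Zq => ->; rewrite mem_next.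
  by rewrite tpermL tpermD.
rewrite [tperm y q x]tpermD 1?eq_sym //.
have [nx | nxy] := eqVneq (next Z x) y; last first.
  by rewrite tpermD 1?eq_sym // next_cycle // ucycle_cycle.
by rewrite nx tpermL -(prev_next uZ x) nx.
Qed.

(** The transposition preserves [D] and fixes [C] pointwise, hence fixes every vertex of
    [rim_nbrs Z]. *)
Lemma swap_rim_nbrs Z y q : uniq Z -> y \in D -> q \in D -> rim_nbrs Z \subset C ->
  rim_nbrs [seq tperm y q x | x <- Z] = rim_nbrs Z.
Proof.
move=> uZ Dy Dq /subsetP UC; set t := tperm y q.
have inj_t : injective t by apply: perm_inj.
have tD x : (t x \in D) = (x \in D).
  rewrite /t; case: tpermP => [->|->|//]; by rewrite Dy Dq.
have rimE : rim (map t Z) = t @: rim Z.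
  apply/setP => x; apply/idP/imsetP.
    rewrite inE [_ \in finset _]inE => /andP[/mapP[z Zz ->]]; rewrite tD => Dz.
    by exists z => //; rewrite inE [_ \in finset _]inE Zz.
  case=> z; rewrite inE [_ \in finset _]inE => /andP[Zz Dz] ->.
  by rewrite inE [_ \in finset _]inE map_f ?tD.
have tU x : x \in rim_nbrs Z -> t x = x.
  move=> /UC Cx; rewrite /t tpermD //.
    by apply: contraTneq Cx => <-; move: Dy; rewrite inE.
  by apply: contraTneq Cx => <-; move: Dq; rewrite inE.
rewrite /rim_nbrs rimE; congr (_ :|: _); apply/setP => x; apply/imsetP/imsetP.
- case=> _ /imsetP[z Dz ->] ->; exists z; rewrite // next_map // tU //.
  by rewrite inE imset_f.
- case=> z Dz ->; exists (t z); first exact: imset_f.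
  by rewrite next_map // tU // inE imset_f.
- case=> _ /imsetP[z Dz ->] ->; exists z; rewrite // prev_map // tU //.
  by rewrite inE imset_f ?orbT.
case=> z Dz ->; exists (t z); first exact: imset_f.
by rewrite prev_map // tU // inE imset_f ?orbT.
Qed.

(** [S] is [rim_nbrs Z]. For a vertex off [Z] this is [off_nbr]; a rim vertex is first moved off the
    cycle by an exchange that keeps [rim_nbrs]. *)
Lemma large_clique_structure Z : longest X Z ->
  exists S : {set V}, [/\ #|S| = k, S \subset C &
    forall x y, x \notin C -> X x y -> y \in S].
Proof.
move=> longZ; have [ucZ maxZ] := longZ; have uZ := ucycle_uniq ucZ.
have szZ := card_rim longZ.
have ltZ : #|rim Z| < k by have := short ucZ; rewrite szZ ltn_add2l.
have inD x : x \notin Z -> x \in D.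
  by move=> Zx; rewrite inE; apply: contra Zx; apply: longest_clique_sub.
have [x0 Zx0] : exists x0, x0 \notin Z.
  have : 0 < #|~: [set x in Z]|.
    by have := cardsC [set x in Z]; rewrite card_set_seq // szZ; lia.
  by case/card_gt0P => x; rewrite !inE; exists x.
pose U := rim_nbrs Z.
have comp x : x \notin Z -> exists Q : {set V},
    [/\ x \in Q, forall q, q \in Q -> q \notin Z, linked X Q, nbhd X Q = U &
     [/\ #|U| = k, rim Z != set0 & U \subset C]].
  move=> Zx; have [Q [Qx disjQ linkQ subN]] := component_off X Zx.
  have Q0 : Q != set0 by apply/set0Pn; exists x.
  have [cardU rim0 UC defU] := component_nbhd longZ linkQ Q0 disjQ subN.
  by exists Q; rewrite -/U in defU; split; rewrite -?defU.
have [_ [_ _ _ _ [cardU /set0Pn[y0 Dy0] UC]]] := comp _ Zx0.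
have Z2 : 1 < size Z by rewrite szZ; lia.
(* Any rim vertex y may be exchanged with a vertex q off the cycle attached to
   the same two rim neighbours; the new cycle is longest with the same U. *)
have swap y x : y \in rim Z -> x \notin Z ->
    longest X [seq tperm y x z | z <- Z] /\ forall z, z \notin Z -> ~~ X x z.
  move=> Dy Zx; have [Q [Qx disjQ linkQ defU _]] := comp _ Zx.
  have [Zy yD] : y \in Z /\ y \in D by move: Dy; rewrite inE [_ \in finset _]inE => /andP.
  have Np : prev Z y \in nbhd X Q by rewrite defU inE imset_f ?orbT.
  have Nn : next Z y \in nbhd X Q by rewrite defU inE imset_f.
  have [r [r0 path_r ur subr]] := link_path longZ linkQ disjQ Np Nn.
  have [Z' ucZ' szZ'] := ucycle_replace ucZ Zy Z2 path_r ur.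
  (* Putting [r] in place of [y] must not lengthen the cycle. *)
  have szr : size r <= 1.
    by have := maxZ _ ucZ'; rewrite -ltnS szZ' -[(size Z).+1]addn1 leq_add2l.
  case: r r0 path_r ur subr szr {szZ'} => [|q [|? ?]] //= _ path_r _ subr _.
  have Qq : q \in Q by apply: subr; rewrite inE.
  have Zq := disjQ _ Qq; case/and3P: path_r => pq qn _.
  have longZq := swap_longest longZ Zy Zq pq qn.
  (* After the exchange [z] is still off the cycle and [q] is on it, so adjacency would put [q] in
     [rim_nbrs], inside [C]. *)
  have isol z : z \notin Z -> ~~ X q z.
    move=> Zz; apply/negP => qz.
    have zq : z != q by apply: contraTneq qz => ->; rewrite edge_irrefl.
    have : q \in rim_nbrs [seq tperm y q z | z <- Z].
      apply: (off_nbr (x := z)) => //; last by rewrite edge_sym.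
        apply/mapP => -[w Zw]; case: tpermP => [_|wq|_ _].
        - by move/eqP: zq.
        - by rewrite wq (negPf Zq) in Zw.
        - by move=> zw; rewrite zw Zw in Zz.
      by apply/mapP; exists y; rewrite ?tpermL.
    rewrite swap_rim_nbrs ?(inD _ Zq) // => /(subsetP UC).
    by have := inD _ Zq; rewrite inE => /negPf->.
  (* Having no neighbour off [Z], [q] is the only vertex of [Q]. *)
  suff <- : q = x by [].
  have [p [path_p <- _ subp]] := linkQ q x Qq Qx.
  case: p path_p subp => //= z p /andP[qz _] subp.
  have Qz : z \in Q by apply: subp; rewrite !inE eqxx orbT.
  by have := isol z (disjQ _ Qz); rewrite qz.
exists U; split=> // x y Cx xy.
have [Zx | Zx] := boolP (x \in Z); last first.
  have [Zy | Zy] := boolP (y \in Z); first exact: off_nbr xy.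
  by have [_ /(_ y Zy)] := swap _ _ Dy0 Zx; rewrite xy.
have Dx : x \in rim Z by rewrite !inE Zx.
have [longZ' _] := swap _ _ Dx Zx0.
have xx0 : x != x0 by apply: contraNneq Zx0 => <-.
have Z'x : x \notin [seq tperm x x0 z | z <- Z].
  apply/mapP => -[w Zw]; case: tpermP => [_|wx|wx _]; first by move/eqP: xx0.
    by rewrite wx (negPf Zx0) in Zw.
  by move=> xw; case: wx.
have UE : rim_nbrs [seq tperm x x0 z | z <- Z] = U.
  by rewrite swap_rim_nbrs ?(inD _ Zx0) // inE.
have [Z'y | Z'y] := boolP (y \in [seq tperm x x0 z | z <- Z]).
  by rewrite -UE; apply: off_nbr xy.
have xy' : x != y by apply: contraTneq xy => <-; rewrite edge_irrefl.
have Zy : y \notin Z.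
  apply: contra Z'y => Zy; apply/mapP; exists y => //; rewrite tpermD //.
  by apply: contraNneq Zx0 => ->.
have : x \in U by apply: off_nbr Zy Zx _; rewrite // edge_sym.
by move/(subsetP UC); rewrite (negPf Cx).
Qed.

End LargeClique.

(** * Closure and edge counting *)

Section AddEdge.
Variables (V : finType) (X : sgraph V) (u v : V).

Definition add_edge_rel : rel V := fun x y =>
  X x y || (u != v) && ((x == u) && (y == v) || (x == v) && (y == u)).

Lemma add_edge_sym : symmetric add_edge_rel.
Proof.
move=> x y; rewrite /add_edge_rel edge_sym; congr (_ || (_ && _)).
by rewrite orbC; congr (_ || _); rewrite andbC.
Qed.

Lemma add_edge_irrefl : irreflexive add_edge_rel.
Proof.
move=> x; rewrite /add_edge_rel edge_irrefl /=.
by case: (eqVneq x u) => [->|_] //=; case: (eqVneq u v) => // _; rewrite andbF.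
Qed.

Definition add_edge := SGraph add_edge_sym add_edge_irrefl.

Lemma sub_add_edge : subrel X add_edge.
Proof. by move=> x y xy; apply/orP; left. Qed.

Lemma add_edgeN w x y : w \in [:: u; v] -> x != w -> y != w ->
  add_edge x y -> X x y.
Proof.
rewrite !inE /= /add_edge_rel.
case/orP => /eqP-> /negPf xw /negPf yw; rewrite ?xw ?yw ?andbF ?orbF //.
Qed.

Lemma path_add_edgeN w x p : w \in [:: u; v] -> w \notin x :: p ->
  path add_edge x p -> path X x p.
Proof.
move=> uvw wp; apply: (sub_in_path (P := fun z => z != w)).
  by move=> y z yw zw; apply: (add_edgeN uvw).
by apply/allP => z; apply: contraTneq => ->.
Qed.

End AddEdge.

Lemma path_avoid_last (V : eqType) (x : V) p : uniq (x :: p) -> p != [::] ->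
  last x p != x.
Proof.
case/lastP: p => // p y; rewrite last_rcons /= mem_rcons inE negb_or.
by rewrite eq_sym => /andP[/andP[]].
Qed.

(* The Bondy-Chvatal stability argument. *)
Lemma add_edge_stable (V : finType) (X : sgraph V) u v m Z : 2 < m ->
    (forall Z, ucycle X Z -> size Z < m) -> ucycle (add_edge X u v) Z ->
    m <= size Z -> u \in Z -> next Z u = v -> u != v ->
  degree X u + degree X v < #|V|.
Proof.
move=> m3 short ucZ szZ Zu nu uv; have uZ := ucycle_uniq ucZ.
pose Nv := [set y | X v y]; pose Nu := [set y | X u y].
have inj_p : injective (prev Z) by apply: can_inj (next_prev uZ).
(* Otherwise the new edge can be avoided: for [w] on [Z], the edges from [v] to [w] and from [u] to
   [prev Z w] replace the cycle edges leaving [u] and [prev Z w]. *)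
have disj w : X v w -> ~~ X u (prev Z w).
  move=> vw; apply/negP => uw.
  have wv : w != v by apply: contraTneq vw => ->; rewrite edge_irrefl.
  have [Zw|Zw] := boolP (w \in Z).
    have Zb : prev Z w \in Z by rewrite mem_prev.
    have ub : u != prev Z w by apply: contraNneq wv => def_u; rewrite -nu def_u next_prev.
    have [p [q [path_p path_q last_p last_q permZ]]] := ucycle_split2 ucZ Zu Zb ub.
    rewrite nu next_prev // in path_p path_q last_p last_q permZ.
    have uniq_pq : uniq ((v :: p) ++ (w :: q)) by rewrite (perm_uniq permZ).
    have u_in_q : u \in w :: q by rewrite -last_q mem_last.
    have u_in_p : u \notin v :: p.
      by move: uniq_pq; rewrite cat_uniq => /and3P[_ /hasPn/(_ _ u_in_q)].
    have v_in_q : v \notin w :: q.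
      move: uniq_pq; rewrite cat_uniq => /and3P[_ /hasPn h _].
      by apply/negP => /h /=; rewrite mem_head.
    have ucZ' : ucycle X ((v :: p) ++ [::] ++ rev (w :: q)).
      apply: ucycle_cross => //; first exact: edge_sym.
      - by apply: path_add_edgeN u_in_p path_p; rewrite mem_head.
      - by apply: path_add_edgeN v_in_q path_q; rewrite !inE eqxx orbT.
      - by rewrite last_p last_q /= edge_sym uw.
      - by rewrite cats0.
    have := short _ ucZ'; rewrite size_cat size_rev -size_cat (perm_size permZ).
    by rewrite ltnNge szZ.
  have [p [path_p last_p permZ _]] := ucycle_cut ucZ Zu.
  rewrite nu in path_p last_p permZ.
  have uvp : uniq (v :: p) by rewrite (perm_uniq permZ).
  have szp : size Z = (size p).+1 by rewrite -(perm_size permZ).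
  (* [prev] is the identity off [Z], so here [w] is a common neighbour of [u] and [v] and goes
     between them in place of the new edge. *)
  have pw : prev Z w = w by rewrite prev_nth (negPf Zw).
  rewrite pw in uw.
  case: p => [|h p] in path_p last_p permZ uvp szp *.
    by move: szZ m3; rewrite szp /=; lia.
  have ucZ' : ucycle X (w :: v :: h :: p).
    apply/andP; split; last by rewrite cons_uniq uvp andbT (perm_mem permZ).
    move: path_p => /= /andP[vh path_h]; rewrite edge_sym vw /=.
    move: uvp; rewrite cons_uniq => /andP[vhp uhp].
    have -> : X v h.
      apply: (@add_edgeN _ X u v u) => //; first by rewrite inE eqxx.
        by rewrite eq_sym.
      apply/negP => /eqP hu; rewrite hu /= in last_p uhp.
      case: p last_p uhp szp {permZ vhp path_h} => [|z p] last_p uhp szp.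
        by move: szZ m3; rewrite szp /=; lia.
      by have /eqP[] := path_avoid_last uhp isT.
    rewrite rcons_path /= in last_p *; rewrite last_p uw andbT.
    by apply: path_add_edgeN vhp path_h; rewrite !inE eqxx orbT.
  by have := short _ ucZ'; rewrite /=; move: szZ; rewrite szp /=; lia.
(* [prev Z], a permutation of all vertices, carries the neighbours of [v] to vertices other than [u]
   and its neighbours. *)
have Av : #|prev Z @: Nv| = degree X v by rewrite card_imset.
have disjA : [disjoint (u |: Nu) & prev Z @: Nv].
  rewrite disjoint_sym; apply/pred0P => y /=; apply/negP => /andP[/imsetP[w]].
  rewrite inE => vw ->; rewrite !inE => /orP[/eqP pu|]; last by rewrite (negPf (disj _ vw)).
  by move: vw; rewrite -nu -pu next_prev // edge_irrefl.
have cu : #|u |: Nu| = (degree X u).+1 by rewrite cardsU1 inE edge_irrefl.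
have := max_card (mem ((u |: Nu) :|: prev Z @: Nv)).
rewrite cardsU; move: disjA; rewrite -setI_eq0 => /eqP->.
by rewrite cards0 subn0 cu Av.
Qed.

Lemma add_edge_no_long_cycle (V : finType) (X : sgraph V) u v m : 2 < m ->
    #|V| <= degree X u + degree X v ->
    (forall Z, ucycle X Z -> size Z < m) ->
  forall Z, ucycle (add_edge X u v) Z -> size Z < m.
Proof.
move=> m3 deg_uv short Z ucZ; rewrite ltnNge; apply/negP => szZ.
have uZ := ucycle_uniq ucZ.
have [/allP allX | /allPn[x Zx nX]] := boolP (all (fun x => X x (next Z x)) Z).
  have ucXZ : ucycle X Z by apply/andP; split=> //; apply: cycle_from_next.
  by have := short _ ucXZ; rewrite ltnNge szZ.
have : add_edge X u v x (next Z x) by apply: next_cycle; rewrite ?ucycle_cycle.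
rewrite /= /add_edge_rel (negPf nX) /= => /andP[uv /orP[] /andP[/eqP xE /eqP nE]].
  have Zu : u \in Z by rewrite -xE.
  rewrite xE in nE.
  by have := add_edge_stable m3 short ucZ szZ Zu nE uv; rewrite ltnNge deg_uv.
(* The cycle runs through the new edge from [v] to [u]; reversing it reduces to the previous
   case. *)
have Zv : v \in rev Z by rewrite mem_rev -xE.
have Zu : u \in rev Z by rewrite mem_rev -nE mem_next.
have nu : next (rev Z) u = v by rewrite next_rev // -nE prev_next.
have ucZ' := ucycle_rev (@edge_sym _ (add_edge X u v)) ucZ.
rewrite -size_rev in szZ.
by have := add_edge_stable m3 short ucZ' szZ Zu nu uv; rewrite ltnNge deg_uv.
Qed.

(** Each edge added between nonadjacent vertices of large degree sum lowers the number of
    nonadjacent pairs, so the process stops. *)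
Lemma closure_exists (V : finType) (X : sgraph V) m : 2 < m ->
    (forall Z, ucycle X Z -> size Z < m) ->
  exists Y : sgraph V, [/\ subrel X Y, forall Z, ucycle Y Z -> size Z < m &
    forall u v, u != v -> ~~ Y u v -> degree Y u + degree Y v < #|V|].
Proof.
move=> m3; pose nonedges (Y : sgraph V) := #|[set p : V * V | ~~ Y p.1 p.2]|.
have [n] := ubnP (nonedges X); elim: n X => // n IH X ltn short.
have [/existsP[u /existsP[v /and3P[uv nuv deg_uv]]] | none] := boolP
  [exists u, exists v, [&& u != v, ~~ X u v & #|V| <= degree X u + degree X v]].
  have [||Y [subY shortY degY]] := IH (add_edge X u v).
  - rewrite -ltnS; apply: leq_trans ltn; rewrite ltnS proper_card //; apply/properP; split.
      by apply/subsetP => p; rewrite !inE; apply: contra; apply: sub_add_edge.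
    exists (u, v); rewrite !inE //= /add_edge_rel uv !eqxx /= ?orbT //.
  - exact: add_edge_no_long_cycle.
  by exists Y; split=> // x y /(@sub_add_edge _ X u v)/subY.
exists X; split=> // u v uv nuv; rewrite ltnNge; apply: contra none => deg_uv.
by apply/existsP; exists u; apply/existsP; exists v; rewrite uv nuv.
Qed.

Lemma degree_mono (V : finType) (X Y : sgraph V) : subrel X Y ->
  forall x, degree X x <= degree Y x.
Proof. by move=> XY x; apply/subset_leq_card/subsetP => y; rewrite !inE; apply: XY. Qed.

Lemma sep_connected_mono k (V : finType) (X Y : sgraph V) : subrel X Y ->
  sep_connected k X -> sep_connected k Y.
Proof.
move=> XY connX Q Q0 QY.
have sub : nbhd X Q \subset nbhd Y Q.
  apply/subsetP => y; rewrite !inE => /andP[-> /existsP[x /andP[Qx xy]]] /=.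
  by apply/existsP; exists x; rewrite Qx XY.
apply: leq_trans (subset_leq_card sub); apply: connX => //.
apply: contraNneq QY => QX; rewrite -subTset -QX; exact: setUS.
Qed.

(* At [d = N./2] the two upper bounds of [clique_count_arith] on the number of
   edges amount to [(N - 1) * (3 * N - 1) / 4]. *)
Lemma half_count_arith N s P : 6 * s + 6 <= N -> 2 * (s * s) + 5 * s + 6 <= 2 * N + P ->
  (N - 1) * (3 * N - 1) < 4 * ((N - s) * (N - s - 1) + P + s).
Proof.
move=> N6 N2; have [j jE] : exists j, N = 6 * s + 6 + j by exists (N - (6 * s + 6)); lia.
have -> : N - 1 = 6 * s + 5 + j by lia.
have -> : 3 * N - 1 = 18 * s + 17 + 3 * j by lia.
have -> : N - s = 5 * s + 6 + j by lia.
have -> : 5 * s + 6 + j - 1 = 5 * s + 5 + j by lia.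
by subst N; lia.
Qed.

(* The bounds on [N] make the convex quadratic bound in [d] smaller than [E] at
   both ends [s.+1] and [N./2] of its range. *)
Lemma clique_count_arith N s k c d h sC sD E :
    c + d = N -> 6 * s + 6 <= N -> 2 * s ^ 2 + 5 * s + 6 <= 2 * N + k * s ->
    (N - s) * (N - s - 1) + (k + 1) * s < E ->
    E = sC + sD -> sC <= c * c.-1 + sD -> sC <= c * N.-1 ->
    sD <= d * d -> sD <= d * h -> 2 * h < N ->
  d <= s.
Proof.
move=> Nc N6; rewrite -mulnn mulnDl mul1n addnA.
move: (k * s) => P N2 hE eE sC1 sC2 sD1 sD2 hN.
rewrite leqNgt; apply/negP => sd.
have bigN := half_count_arith N6 N2.
have [d2|d2] := leqP N (2 * d).
  suff : 4 * E <= (N - 1) * (3 * N - 1) by lia.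
  have leE : E <= c * N.-1 + d * h by lia.
  have [j jE] : exists j, d = c + j by exists (d - c); lia.
  have [c' cE] : exists c', N = c'.+1 by exists N.-1; lia.
  (* At [d = c] parity is needed: [2 * h < 2 * c] gives [h <= c - 1]. *)
  case: j => [|j] in jE.
    have [c'' c''E] : exists c'', c = c''.+1 by exists c.-1; lia.
    have hc : h <= c'' by lia.
    have dh : d * h <= d * c'' by rewrite leq_mul2l hc orbT.
    have -> : N - 1 = 2 * c'' + 1 by lia.
    have -> : 3 * N - 1 = 6 * c'' + 5 by lia.
    have NE : N.-1 = 2 * c'' + 1 by lia.
    have dE : d = c''.+1 by lia.
    by rewrite NE dE c''E in leE dh *; lia.
  have hc : 2 * h <= 2 * c + j by lia.
  have dh : d * (2 * h) <= d * (2 * c + j) by rewrite leq_mul2l hc orbT.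
  have -> : N - 1 = 2 * c + j by lia.
  have -> : 3 * N - 1 = 6 * c + 3 * j + 2 by lia.
  have NE : N.-1 = 2 * c + j by lia.
  by rewrite NE jE in leE dh *; lia.
have EF : E <= c * c.-1 + 2 * (d * d) by lia.
have [j jE] : exists j, d = s + 1 + j by exists (d - s.+1); lia.
have [i iE] : exists i, N = 2 * d + i.+1 by exists (N - (2 * d).+1); lia.
have cE : c = s + j + i + 2 by lia.
have cE' : c.-1 = s + j + i + 1 by lia.
rewrite cE' cE jE in EF.
(* With [N] fixed, [j + 2 * i] decreases in [d]. For small [d] the bound [EF] contradicts [hE] and
   [N2]; for large [d] it contradicts [hE] and [bigN]. *)
have [small|large] := leqP (2 * s + 1) (j + 2 * i).
  have jsmall : j * (2 * s + 1) <= j * (j + 2 * i) by rewrite leq_mul2l small orbT.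
  have NE1 : N - s - 1 = s + 2 * j + i + 2 by lia.
  have NE : N - s = s + 2 * j + i + 3 by lia.
  by rewrite NE1 NE in hE; lia.
have iis : i * i <= i * s by rewrite leq_mul2l; apply/orP; right; lia.
suff : 4 * E <= (N - 1) * (3 * N - 1) by lia.
have -> : N - 1 = 2 * s + 2 * j + i + 2 by lia.
have -> : 3 * N - 1 = 6 * s + 6 * j + 3 * i + 8 by lia.
by lia.
Qed.

(** Vertices of degree at least half the order are pairwise adjacent; [C] is a maximal clique
    containing them. A vertex outside [C] misses some vertex of [C], of degree at least [#|C| - 1],
    so its own degree is at most [#|D|], and also below half the order. The edge count then bounds
    [#|D|] by [s]. *)
Lemma large_clique_exists (V : finType) (X : sgraph V) s k :
    (forall u v, u != v -> ~~ X u v -> degree X u + degree X v < #|V|) ->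
    6 * s + 6 <= #|V| -> 2 * s ^ 2 + 5 * s + 6 <= 2 * #|V| + k * s ->
    (#|V| - s) * (#|V| - s - 1) + (k + 1) * s < \sum_x degree X x ->
  exists C : {set V}, {in C &, forall x y, x != y -> X x y} /\ #|C| + s = #|V|.
Proof.
move=> ore N6 N2 hE; set N := #|V| in ore N6 N2 hE *.
pose clique (A : {set V}) := [forall x in A, forall y in A, (x != y) ==> X x y].
have cliqueP (A : {set V}) : reflect {in A &, forall x y, x != y -> X x y} (clique A).
  apply: (iffP forall_inP) => [h x y Ax Ay xy | h x Ax].
    by have /forall_inP/(_ y Ay)/implyP := h x Ax; apply.
  by apply/forall_inP => y Ay; apply/implyP; apply: h.
pose hi := [set x | N <= 2 * degree X x].
have : clique hi.
  apply/cliqueP => x y; rewrite !inE => hx hy xy.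
  by apply: contraT => /(ore _ _ xy); lia.
case/(@maxset_exists _ clique) => C /maxsetP[/cliqueP clC maxC] hiC.
pose D := ~: C.
have cCD : #|C| + #|D| = N by apply: cardsC.
have degN x : degree X x <= N.-1.
  rewrite -ltnS (leq_trans _ (leqSpred _)) // -[X in _ <= X]cardsT.
  apply/proper_card/properP; split; first exact: subsetT.
  by exists x; rewrite ?inE // edge_irrefl.
have degC x : x \in C -> #|[set y | X x y] :&: C| = #|C|.-1.
  move=> Cx; rewrite [X in _ = X.-1](cardsD1 x) Cx /=; apply: eq_card => y.
  rewrite !inE; have [->|yx] := eqVneq y x; first by rewrite edge_irrefl.
  by have [Cy|] := boolP (y \in C); rewrite ?andbF // andbT clC // eq_sym.
have degD x : x \in D -> degree X x <= #|D|.
  rewrite inE => Cx.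
  have [u [Cu ux nux]] : exists u, [/\ u \in C, u != x & ~~ X u x].
    have [/exists_inP[u Cu /andP[]]|none] := boolP [exists u in C, (u != x) && ~~ X u x].
      by exists u.
    have clxC : clique (x |: C).
      apply/cliqueP => y z /setU1P[->|Cy] /setU1P[->|Cz] yz.
      - by rewrite eqxx in yz.
      - apply: contraR none => nX; apply/exists_inP; exists z => //.
        by rewrite eq_sym yz edge_sym.
      - by apply: contraR none => nX; apply/exists_inP; exists y => //; rewrite yz.
      exact: clC.
    by have := maxC _ clxC (subsetUr _ _); move/setP/(_ x); rewrite setU11 (negPf Cx).
  have := ore _ _ ux nux; have := degC _ Cu.
  have := subset_leq_card (subsetIl [set y | X u y] C); rewrite -/(degree X u).
  have : 0 < #|C| by apply/card_gt0P; exists u.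
  by lia.
have degD2 x : x \in D -> degree X x <= N.-1./2.
  rewrite inE => Cx; have : x \notin hi by apply: contra Cx; apply/subsetP.
  by rewrite inE; lia.
have sumE : \sum_x degree X x = \sum_(x in C) degree X x + \sum_(x in D) degree X x.
  by rewrite (bigID (mem C)) /=; congr (_ + _); apply: eq_bigl => x; rewrite inE.
have sC2 : \sum_(x in C) degree X x <= #|C| * N.-1.
  by rewrite -sum_nat_const; apply: leq_sum => x _.
have sD1 : \sum_(x in D) degree X x <= #|D| * #|D|.
  by rewrite -sum_nat_const; apply: leq_sum.
have sD2 : \sum_(x in D) degree X x <= #|D| * N.-1./2.
  by rewrite -sum_nat_const; apply: leq_sum.
have sC1 : \sum_(x in C) degree X x <= #|C| * #|C|.-1 + \sum_(x in D) degree X x.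
  have -> : \sum_(x in C) degree X x =
      \sum_(x in C) #|[set y | X x y] :&: C| + \sum_(x in C) #|[set y | X x y] :\: C|.
    by rewrite -big_split; apply: eq_bigr => x _; rewrite /= cardsID.
  rewrite (eq_bigr _ degC) sum_nat_const leq_add2l.
  have cardIE (A : {set V}) x : #|[set y | X x y] :&: A| = \sum_(y in A) X x y.
    rewrite -sum1_card [RHS]big_mkcond [LHS]big_mkcond; apply: eq_bigr => y _.
    by rewrite !inE; case: (X x y); case: (y \in A).
  under eq_bigr do rewrite setDE cardIE.
  rewrite exchange_big; apply: leq_sum => y _.
  under eq_bigr do rewrite edge_sym.
  by rewrite -cardIE subset_leq_card // subsetIl.
have hN : 2 * N.-1./2 < N by have := odd_double_half N.-1; lia.
have Ds := clique_count_arith cCD N6 N2 hE sumE sC1 sC2 sD1 sD2 hN.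
(* The maximal clique may be larger, so it is trimmed to exactly [N - s] vertices. *)
exists [set x in take (N - s) (enum C)]; split.
  move=> x y; rewrite !inE => /mem_take; rewrite mem_enum => Cx /mem_take.
  by rewrite mem_enum => Cy; apply: clC.
rewrite card_set_seq ?take_uniq ?enum_uniq // size_takel -?cardE //; lia.
Qed.

Lemma longest_exists (V : finType) (X : sgraph V) : exists Z, longest X Z.
Proof.
pose P n := [exists Z : n.-tuple V, cycle X Z && uniq Z].
have P0 : exists n, P n by exists 0; apply/existsP; exists [tuple].
have Pb n : P n -> n <= #|V|.
  by case/existsP => Z /andP[_ /card_uniqP cZ]; rewrite -(size_tuple Z) -cZ max_card.
case: (ex_maxnP P0 Pb) => n /existsP[Z ucZ] maxn; exists Z; split=> // Z' ucZ'.
by rewrite size_tuple maxn //; apply/existsP; exists (in_tuple Z').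
Qed.

(** It suffices to treat the closure: it still has no long cycle, and the conclusion passes to its
    subgraph [X]. *)
Theorem long_cycle_or_independent (V : finType) (X : sgraph V) s k :
    2 <= k -> k <= s -> 6 * s + 6 <= #|V| ->
    2 * s ^ 2 + 5 * s + 6 <= 2 * #|V| + k * s -> sep_connected k X ->
    (#|V| - s) * (#|V| - s - 1) + (k + 1) * s < \sum_x degree X x ->
    (forall Z, ucycle X Z -> size Z + s < #|V| + k) ->
  exists S D : {set V}, [/\ #|S| = k, #|D| = s, [disjoint S & D] &
    forall x y, x \in D -> X x y -> y \in S].
Proof.
move=> k2 ks N6 N2 connX hE short.
have [|Z ucZ|Y [XY shortY oreY]] := @closure_exists _ X (#|V| - s + k).
- by lia.
- by have := short Z ucZ; lia.
have [|C [clC cardC]] := large_clique_exists oreY N6 N2.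
  by apply: leq_trans hE _; apply: leq_sum => x _; apply: degree_mono.
have [Z longZ] := longest_exists Y.
have [|||S [cardS SC nbrS]] := large_clique_structure clC cardC k2 ks _ _ _ longZ.
- by lia.
- exact: sep_connected_mono connX.
- by move=> Z' /shortY; lia.
exists S, (~: C); split=> //.
- by rewrite cardsCs finset.setCK; lia.
- by rewrite disjoints_subset finset.setCK.
by move=> x y; rewrite inE => Cx /XY; apply: nbrS.
Qed.

(** * Cones and spanning trees *)

Lemma connect_exit (T : finType) (e : rel T) (A : pred T) x y :
  connect e x y -> A x -> ~~ A y -> exists u v, [/\ A u, ~~ A v & e u v].
Proof.
case/connectP=> p; elim: p x => [|z p IH] x /=; first by move=> _ -> ->.
case/andP=> xz path_p def_y Ax Ay; have [Az|Az] := boolP (A z).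
  exact: IH path_p def_y Az Ay.
by exists x, z.
Qed.

Section Cone.
Variables (T : finType) (G : sgraph T).

Let Some_injT : injective (@Some T). Proof. by move=> x y []. Qed.

(** The apex [None] turns a path of [G] into a cycle and raises the connectivity by one. *)
Definition cone_rel : rel (option T) := fun x y =>
  match x, y with
  | Some x, Some y => G x y
  | None, None => false
  | _, _ => true
  end.

Lemma cone_sym : symmetric cone_rel.
Proof. by move=> [x|] [y|] //=; rewrite edge_sym. Qed.

Lemma cone_irrefl : irreflexive cone_rel.
Proof. by move=> [x|] //=; rewrite edge_irrefl. Qed.

Definition cone := SGraph cone_sym cone_irrefl.

Lemma degree_cone_apex : degree cone None = #|T|.
Proof.
rewrite /degree -(card_imset _ Some_injT); apply: eq_card => -[y|].
  by rewrite inE /=; apply/esym/imsetP; exists y.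
by rewrite inE /=; apply/esym/imsetP => -[].
Qed.

Lemma degree_cone_base x : degree cone (Some x) = (degree G x).+1.
Proof.
rewrite /degree -(card_imset [set y | G x y] Some_injT).
have -> : [set y | cone (Some x) y] = None |: [set Some y | y in [set y | G x y]].
  apply/setP => -[y|]; rewrite !inE //=; apply/idP/imsetP => [xy|[z]].
    by exists y; rewrite ?inE.
  by rewrite inE => xz [->].
rewrite cardsU1; case: imsetP => [[]|_] //.
Qed.

Lemma sum_degree_cone :
  \sum_x degree cone x = \sum_x degree G x + 2 * #|T|.
Proof.
rewrite (bigD1 None) //= degree_cone_apex.
rewrite (reindex_omap Some id) /=; last by case.
have -> : \sum_(j | (Some j != None :> option T) && (Some j == Some j)) degree cone (Some j)
          = \sum_j (degree G j + 1).
  by apply: eq_big => [x|x _]; rewrite ?eqxx // degree_cone_base addn1.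
have cT : #|xpredT : pred T| = #|T| by apply: eq_card.
by rewrite big_split /= sum1_card cT; lia.
Qed.

(** Deleting the neighbourhood of [Q] separates [Q] from the rest. *)
Lemma t_connected_nbhd t (Q : {set T}) : t_connected t G -> Q != set0 ->
  Q :|: nbhd G Q != [set: T] -> t <= #|nbhd G Q|.
Proof.
move=> [_ connG] /set0Pn[x Qx] QT; rewrite leqNgt; apply/negP => ltN.
have [y Qy] : exists y, y \notin Q :|: nbhd G Q.
  apply/existsP; apply: contraR QT; rewrite negb_exists => /forallP h.
  by apply/eqP/setP => y; rewrite in_setT; have := h y; rewrite negbK.
have Nx : x \in ~: nbhd G Q by rewrite !inE Qx.
have [nQy nNy] : y \notin Q /\ y \in ~: nbhd G Q.
  by move: Qy; rewrite inE negb_or => /andP[? ?]; rewrite inE.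
have [_ /(_ (exist _ x Nx) (exist _ y nNy)) conn] := connG _ ltN.
have [[u Nu] [[v Nv] [/= Qu Qv uv]]] :=
  connect_exit (A := fun w => val w \in Q) conn Qx nQy.
have : v \in nbhd G Q.
  by rewrite inE Qv /=; apply/existsP; exists u; rewrite Qu.
by have := Nv; rewrite inE => /negPf->.
Qed.

(** The apex is adjacent to everything, so it cannot lie in [Q]; it is then one more neighbour
    besides those in [G]. *)
Lemma sep_connected_cone t : t_connected t G -> sep_connected t.+1 cone.
Proof.
move=> connG Q /set0Pn[q Qq] QT.
have apexQ : None \notin Q.
  apply: contra QT => Q0; apply/eqP/setP => y; rewrite !inE.
  case: (boolP (y \in Q)) => //= Qy; apply/existsP; exists None; rewrite Q0 /=.
  by case: y Qy => //; rewrite Q0.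
case: q Qq => [x Qx|]; last by rewrite (negPf apexQ).
pose Q' := [set y | Some y \in Q].
have nbhdE y : (Some y \in nbhd cone Q) = (y \in nbhd G Q').
  rewrite !inE; congr (_ && _); apply/existsP/existsP => -[z /andP[Qz zy]].
    by case: z Qz zy => [z|] Qz zy; [exists z; rewrite inE Qz | rewrite Qz in apexQ].
  by exists (Some z); rewrite inE in Qz; rewrite Qz.
have apexN : None \in nbhd cone Q.
  by rewrite inE apexQ; apply/existsP; exists (Some x); rewrite Qx.
have tN : t <= #|nbhd G Q'|.
  apply: t_connected_nbhd => //; first by apply/set0Pn; exists x; rewrite inE.
  apply: contra QT => /eqP/setP QT; apply/eqP/setP => -[y|]; rewrite inE.
    by have := QT y; rewrite inE nbhdE !inE.
  by rewrite apexN orbT inE.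
rewrite (cardsD1 None) apexN add1n ltnS (leq_trans tN) //.
rewrite -(card_imset _ Some_injT) subset_leq_card //.
by apply/subsetP => _ /imsetP[y Ny ->]; rewrite in_setD1 nbhdE Ny.
Qed.

(** The apex is deleted from a cycle through it; any other cycle lies in [G] and is opened
    anywhere. *)
Lemma cone_cycle_path Z : ucycle cone Z -> 2 < size Z ->
  exists x p, [/\ path G x p, uniq (x :: p) & size Z <= (size p).+2].
Proof.
move=> ucZ Z3.
have drop_apex (W : seq (option T)) : None \notin W -> exists W', W = map Some W'.
  elim: W => [|[x|] W IH]; first by exists [::].
    rewrite inE /= => /IH[W' ->]; by exists (x :: W').
  by rewrite inE eqxx.
have [Z0|Z0] := boolP (None \in Z).
  have [i W def_W] := rot_to Z0.
  have szW : size Z = (size W).+1 by rewrite -(size_rot i) def_W.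
  have : ucycle cone (None :: W) by rewrite -def_W rot_ucycle.
  case/andP=> /= path_W /andP[W0 uW].
  have [W' def_W'] := drop_apex _ W0; rewrite {}def_W' in path_W uW szW.
  rewrite (map_inj_uniq Some_injT) in uW; rewrite size_map in szW.
  case: W' => [|x p] in path_W uW szW; first by rewrite szW in Z3.
  exists x, p; split=> //; last by rewrite szW.
  move: path_W; rewrite /= rcons_path => /andP[].
  by rewrite path_map.
have [W' def_Z] := drop_apex _ Z0; rewrite {}def_Z in ucZ Z3 *.
case: W' => [|x p] // in ucZ Z3 *.
exists x, p; case/andP: ucZ => cZ uZ; split.
- by move: cZ; rewrite /= rcons_path path_map => /andP[].
- by rewrite (map_inj_uniq Some_injT) in uZ.
by rewrite size_map /=.
Qed.

End Cone.

(** * Trees rooted at [z], given by a parent function that lowers a rank *)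

Section ParentTree.
Variables (T : finType) (z : T) (f : T -> T) (r : T -> nat).
Hypothesis rank_f : forall x, x != z -> r (f x) < r x.

Definition parent_rel : rel T := fun x y =>
  (x != z) && (f x == y) || (y != z) && (f y == x).

Lemma parent_sym : symmetric parent_rel.
Proof. by move=> x y; rewrite /parent_rel orbC. Qed.

Lemma parent_irrefl : irreflexive parent_rel.
Proof.
move=> x; rewrite /parent_rel orbb; apply/negP => /andP[xz /eqP fx].
by have := rank_f xz; rewrite fx ltnn.
Qed.

Definition parent_graph := SGraph parent_sym parent_irrefl.

Lemma parent_graph_connected : connected parent_graph.
Proof.
split; first by apply/card_gt0P; exists z.
have toz x : connect parent_graph x z.
  have [n] := ubnP (r x); elim: n x => // n IH x ltn.
  have [-> | xz] := eqVneq x z; first exact: connect0.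
  apply: (connect_trans (y := f x)).
    by apply: connect1; rewrite /= /parent_rel xz eqxx.
  by apply: IH; have := rank_f xz; lia.
move=> x y; apply: (connect_trans (toz x)).
by rewrite (sym_connect_sym parent_sym).
Qed.

(* Both neighbours of a vertex of maximal rank on a cycle are its parent. *)
Lemma parent_graph_acyclic : acyclic parent_graph.
Proof.
move=> p ucp; have up := ucycle_uniq ucp; have cp := ucycle_cycle ucp.
case: p => [|x0 p0] // in ucp up cp *; set p := x0 :: p0 in ucp up cp *.
have px0 : x0 \in p by rewrite inE eqxx.
pose x := [arg max_(i > x0 in p) r i].
have [px maxx] : x \in p /\ forall y, y \in p -> r y <= r x.
  by rewrite /x; case: arg_maxnP.
have par y : y \in p -> parent_rel x y -> y = f x.
  move=> py /orP[/andP[_ /eqP] // | /andP[yz /eqP fy]].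
  by have := rank_f yz; rewrite fy ltnNge maxx.
have n1 : next p x = f x by apply: par; rewrite ?mem_next //; apply: next_cycle.
have n2 : prev p x = f x.
  by apply: par; rewrite ?mem_prev // parent_sym; apply: prev_cycle.
have nn : next p (next p x) = x by rewrite n1 -n2 next_prev.
have [i q def_q] := rot_to px.
have nE := next_rot i up; rewrite def_q in nE.
have szq : size p = (size q).+1 by rewrite -(size_rot i) def_q.
have uq : uniq (x :: q) by rewrite -def_q rot_uniq.
rewrite szq; case: q {def_q szq} nE uq => [|y [|w q]] // nE uq; exfalso.
have ny : next p x = y by rewrite -nE /= eqxx.
move: nn; rewrite ny -nE /=.
case/and3P: uq; rewrite !inE !negb_or => /and3P[xy xw _] _ _.
by rewrite eqxx [y == x]eq_sym (negPf xy) => wx; rewrite wx eqxx in xw.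
Qed.

End ParentTree.

(** Connectedness gives an edge leaving the vertices listed so far, whose far end is listed next.
    The earlier neighbour will provide a parent. *)
Lemma extend_enum (T : finType) (G : sgraph T) (l0 : seq T) : connected G ->
    uniq l0 -> l0 != [::] ->
  exists l, [/\ uniq (l0 ++ l), forall y, y \in l0 ++ l &
    forall y, y \in l -> has (G y) (take (index y (l0 ++ l)) (l0 ++ l))].
Proof.
move=> [_ connG] ul0 l0n0.
suff main n l : #|T| - size (l0 ++ l) <= n -> uniq (l0 ++ l) ->
    (forall y, y \in l -> has (G y) (take (index y (l0 ++ l)) (l0 ++ l))) ->
  exists l, [/\ uniq (l0 ++ l), forall y, y \in l0 ++ l &
    forall y, y \in l -> has (G y) (take (index y (l0 ++ l)) (l0 ++ l))].
  by apply: (main #|T| [::]); rewrite ?cats0 ?leq_subr.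
elim: n l => [|n IH] l szl ul hl.
  exists l; split=> // y; apply: contraT => ly.
  have := max_card (mem (y :: l0 ++ l)).
  have /card_uniqP -> : uniq (y :: l0 ++ l) by rewrite /= ly.
  by rewrite ltnNge -subn_eq0 -leqn0 szl.
have [/allP alll | /allPn[y _ ly]] := boolP (all (fun y => y \in l0 ++ l) (enum T)).
  by exists l; split=> // y; apply: alll; rewrite mem_enum.
case: l0 => [|x0 l0'] // in l0n0 ul0 szl ul hl ly IH *.
set l0 := x0 :: l0' in ul0 szl ul hl ly IH *.
have lx0 : x0 \in l0 ++ l by rewrite inE eqxx.
have [u [v [lu lv uv]]] := connect_exit (A := fun z => z \in l0 ++ l) (connG x0 y) lx0 ly.
apply: (IH (rcons l v)).
- by rewrite -rcons_cat size_rcons; lia.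
- by rewrite -rcons_cat rcons_uniq lv.
move=> w; rewrite -rcons_cat mem_rcons inE => /orP[/eqP-> | lw].
  have iv : index v [:: v] = 0 by rewrite /= eqxx.
  rewrite -cats1 index_cat (negPf lv) iv addn0 take_size_cat //.
  by apply/hasP; exists u => //; rewrite edge_sym.
have lw' : w \in l0 ++ l by rewrite mem_cat lw orbT.
rewrite -cats1 index_cat lw' takel_cat; first exact: hl.
by rewrite ltnW // index_mem.
Qed.

(* The path is completed to a spanning tree in which its inner vertices keep
   degree at least two. *)
Lemma path_spanning_tree (T : finType) (G : sgraph T) x p k : connected G ->
    path G x p -> uniq (x :: p) -> #|T| <= (size p).-1 + k ->
  has_spanning_ended_tree k G.
Proof.
move=> connG path_p up szp; set l0 := x :: p in up.
have [l' [ul alll hl]] := extend_enum connG up isT.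
set l := l0 ++ l' in ul alll hl.
have nthl i : i < size l0 -> nth x l i = nth x l0 i by move=> h; rewrite /l nth_cat h.
have szl : size l0 <= size l by rewrite /l size_cat leq_addr.
have indexl0 y : y \in l0 -> index y l = index y l0 by move=> h; rewrite /l index_cat h.
have edge_l0 i : i.+1 < size l0 -> G (nth x l0 i) (nth x l0 i.+1).
  by move=> h; have /(pathP x) := path_p; apply; rewrite /= in h.
(* On the path the parent is the previous vertex; elsewhere it is the first neighbour in [l], which
   comes before [y]. *)
pose f y := if y \in l0 then nth x l (index y l).-1 else nth x l (find (G y) l).
pose r y := index y l.
have ix : index x l = 0 by rewrite /= eqxx.
have index0 y : y != x -> 0 < index y l.
  by move=> yx; rewrite /= eq_sym (negPf yx).
have off y : y \notin l0 -> find (G y) l < index y l /\ has (G y) l.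
  move=> l0y; have l'y : y \in l' by have := alll y; rewrite mem_cat (negPf l0y).
  have h := hl y l'y.
  have szt : size (take (index y l) l) = index y l by rewrite size_takel // index_size.
  have lE := cat_take_drop (index y l) l.
  split; last by rewrite -lE has_cat h.
  by rewrite -{1}lE find_cat h -[ltnRHS]szt -has_find.
have rank_f y : y != x -> r (f y) < r y.
  move=> yx; rewrite /r /f; case: ifPn => [l0y|/off[lt_f _]].
    have y0 := index0 y yx; rewrite index_uniq //; first by lia.
    by rewrite (leq_ltn_trans (leq_pred _)) // index_mem.
  by rewrite index_uniq // (ltn_trans lt_f) // index_mem.
have adj_f y : y != x -> G y (f y).
  move=> yx; rewrite /f; case: ifPn => [l0y|/off[_ h]]; last exact: nth_find.
  have y0 := index0 y yx; rewrite indexl0 // in y0 *.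
  have iy : index y l0 < size l0 by rewrite index_mem.
  rewrite nthl; last by lia.
  have := edge_l0 (index y l0).-1; rewrite prednK // nth_index // edge_sym; exact.
pose H := parent_graph rank_f.
exists H.
  split; last by split; [apply: parent_graph_connected | apply: parent_graph_acyclic].
  by move=> y z /orP[] /andP[yx /eqP <-]; rewrite ?adj_f // edge_sym adj_f.
have edgeH i : i.+1 < size l0 -> H (nth x l0 i.+1) (nth x l0 i).
  move=> ilt; apply/orP; left.
  have l0i : nth x l0 i.+1 \in l0 by rewrite mem_nth.
  rewrite /f l0i indexl0 // index_uniq // nthl ?(ltnW ilt) // eqxx andbT.
  by rewrite -[X in _ != X]/(nth x l0 0) nth_uniq.
(* Positions [1] to [(size p).-1]: both path edges at such a vertex belong to [H], so it is no
   leaf. *)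
pose inner := [set nth x l0 (val i).+1 | i : 'I_(size p).-1].
have cin : #|inner| = (size p).-1.
  rewrite card_imset ?card_ord // => i j /eqP.
  by rewrite nth_uniq // => [/eqP[]/val_inj||] //=; have := ltn_ord i; have := ltn_ord j; lia.
have sub : leaves H \subset ~: inner.
  apply/subsetP => y; rewrite !inE => /eqP deg1; apply/negP => /imsetP[i _ yE].
  have il := ltn_ord i.
  have i1 : (val i).+2 < size l0 by rewrite /=; lia.
  have a1 := edgeH _ (ltnW i1).
  have a2 := edgeH _ i1; rewrite edge_sym in a2.
  have ne : nth x l0 (val i) != nth x l0 (val i).+2.
    rewrite nth_uniq ?(ltnW (ltnW i1)) //; lia.
  have : #|[set nth x l0 (val i); nth x l0 (val i).+2]| <= degree H y.
    apply/subset_leq_card/subsetP => z; rewrite !inE yE => /orP[]/eqP->; [exact: a1|exact: a2].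
  by rewrite cards2 ne deg1.
have := subset_leq_card sub; have := cardsC inner; rewrite cin; lia.
Qed.

Lemma t_connected_connected (t : nat) (T : finType) (G : sgraph T) : (0 < t)%N ->
  t_connected t G -> connected G.
Proof.
move=> t0 tG; split; first by case: tG => tT _; apply: leq_ltn_trans tT.
move=> x y; pose Q := [set z | connect G x z].
have Q0 : Q != set0 by apply/set0Pn; exists x; rewrite inE connect0.
have N0 : nbhd G Q = set0.
  apply/setP => z; rewrite !inE; apply/negP => /andP[nz /existsP[w /andP[]]].
  rewrite inE => xw wz; case/negP: nz; apply: connect_trans xw _; exact: connect1.
have [QT|QT] := eqVneq (Q :|: nbhd G Q) [set: T].
  by have := in_setT y; rewrite -QT N0 setU0 inE.
by have := t_connected_nbhd tG Q0 QT; rewrite N0 cards0 leqn0; lia.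
Qed.

Lemma t_connected_degree (t : nat) (T : finType) (G : sgraph T) x :
  t_connected t G -> (t <= degree G x)%N.
Proof.
move=> tG; pose Q := [set x].
have NE : nbhd G Q = [set y | G x y].
  apply/setP => y; rewrite !inE; apply/andP/idP => [[_ /existsP[z]]|xy].
    by rewrite inE => /andP[/eqP->].
  split; first by apply: contraTneq xy => ->; rewrite edge_irrefl.
  by apply/existsP; exists x; rewrite inE eqxx.
have Q0 : Q != set0 by apply/set0Pn; exists x; rewrite inE.
have [QT|QT] := eqVneq (Q :|: nbhd G Q) [set: T].
  case: tG => tT _; rewrite -ltnS (leq_trans tT) // -cardsT -QT NE.
  by rewrite cardsU1 inE edge_irrefl.
by have := t_connected_nbhd tG Q0 QT; rewrite NE.
Qed.

(** [D] is independent because its neighbours lie in [S]. That [f] also reflects edges will come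
    from the spectral comparison. *)
Lemma join_embedding (T : finType) (G : sgraph T) (t m s : nat) (S D : {set T}) :
    #|T| = t + (m + s) -> #|S| = t -> #|D| = s -> [disjoint S & D] ->
    (forall x y, x \in D -> G x y -> y \in S) ->
  exists2 f : T -> 'I_t + ('I_m + 'I_s), bijective f & forall x y, G x y ->
    join (complete t) (disjoint_union (complete m) (empty s)) (f x) (f y).
Proof.
move=> cT cS cD dSD nbrD; pose M := ~: (S :|: D).
have cM : #|M| = m.
  have := cardsC (S :|: D); rewrite cardsU; move: dSD; rewrite -setI_eq0 => /eqP->.
  by rewrite cards0 -/M; lia.
pose g (z : 'I_t + ('I_m + 'I_s)) : T :=
  match z with
  | inl i => enum_val (cast_ord (esym cS) i)
  | inr (inl i) => enum_val (cast_ord (esym cM) i)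
  | inr (inr i) => enum_val (cast_ord (esym cD) i)
  end.
have gS i : g (inl i) \in S by apply: enum_valP.
have gM i : g (inr (inl i)) \in M by apply: enum_valP.
have gD i : g (inr (inr i)) \in D by apply: enum_valP.
have MS x : x \in M -> x \in S = false.
  by rewrite !inE negb_or => /andP[/negPf].
have MD x : x \in M -> x \in D = false.
  by rewrite !inE negb_or => /andP[_ /negPf].
have DS x : x \in D -> x \in S = false.
  by move=> Dx; apply/negP => Sx; have /pred0P/(_ x) := dSD; rewrite /= Sx Dx.
have inj_g : injective g.
  case=> [i|[i|i]] [j|[j|j]] e.
  - by move/enum_val_inj: e => /cast_ord_inj->.
  - by have := gS i; rewrite e MS.
  - by have := gS i; rewrite e DS.
  - by have := gS j; rewrite -e MS.
  - by move/enum_val_inj: e => /cast_ord_inj->.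
  - by have := gD j; rewrite -e MD.
  - by have := gS j; rewrite -e DS.
  - by have := gD i; rewrite e MD.
  - by move/enum_val_inj: e => /cast_ord_inj->.
have [|f fK gK] := inj_card_bij inj_g.
  by rewrite !card_sum !card_ord cT.
exists f; first by exists g.
move=> x y xy; rewrite -(gK x) -(gK y) in xy.
case: (f x) (f y) xy => [i|[i|i]] [j|[j|j]] // xy.
- by rewrite /= /complete_rel; apply: contraTneq xy => ->; rewrite edge_irrefl.
- by rewrite /= /complete_rel; apply: contraTneq xy => ->; rewrite edge_irrefl.
- by rewrite edge_sym in xy; have := nbrD _ _ (gD j) xy; rewrite MS.
- by have := nbrD _ _ (gD i) xy; rewrite MS.
- by have := nbrD _ _ (gD i) xy; rewrite DS.
Qed.

(** Expanded, the two inequalities agree: the quadratic bound on [n] is the order condition of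
    [long_cycle_or_independent] for the cone. *)
Lemma order_bound_arith (k t n : nat) : (0 < k)%N ->
    (2 * k ^ 2 + 3 * (k * t) + t ^ 2 + t + 2 <= 2 * n)%N ->
  (2 * (k + t - 1) ^ 2 + 5 * (k + t - 1) + 6 <= 2 * n.+1 + t.+1 * (k + t - 1))%N.
Proof.
case: k => // k _; have -> : (k.+1 + t - 1 = k + t)%N by lia.
by rewrite -!mulnn; lia.
Qed.

(** * Spectra *)

From mathcomp Require Import classical_sets reals boolp.
Import Order.TTheory GRing.Theory Num.Theory.
Local Open Scope ring_scope.

Section Spectrum.
Variable R : realType.

Lemma poly_roots_seq (p : {poly R}) : p != 0 ->
  exists rs : seq R, forall x, root p x -> x \in rs.
Proof.
have [n] := ubnP (size p); elim: n p => // n IH p ltn p0.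
have [[a pa]|noroot] := pselect (exists a, root p a); last first.
  by exists [::] => x px; case: noroot; exists x.
have /factor_theorem[q pE] := pa.
have q0 : q != 0 by apply: contraNneq p0 => q0; rewrite pE q0 mul0r.
have [|rs hrs] := IH q _ q0.
  by move: ltn; rewrite pE size_Mmonic ?monicXsubC // size_XsubC addn2 /=.
exists (a :: rs) => x; rewrite pE rootM root_XsubC inE => /orP[/hrs->|->] //.
by rewrite orbT.
Qed.

Lemma seq_max (rs : seq R) (P : R -> Prop) : (exists2 x, x \in rs & P x) ->
  exists m, P m /\ forall x, x \in rs -> P x -> x <= m.
Proof.
elim: rs => [[]|a rs IH] //.
have [/IH[m [Pm maxm]] _|none] := pselect (exists2 x, x \in rs & P x); last first.
  case=> x; rewrite inE => /orP[/eqP-> Pa|rsx Px]; last by case: none; exists x.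
  exists a; split=> // y; rewrite inE => /orP[/eqP->|rsy Py] //.
  by case: none; exists y.
have [[Pa am]|h] := pselect (P a /\ m < a).
  exists a; split=> // y; rewrite inE => /orP[/eqP->|/maxm h /h] // hy.
  by rewrite (le_trans hy) // ltW.
exists m; split=> // y; rewrite inE => /orP[/eqP->|/maxm h' /h'] // Pa.
by rewrite leNgt; apply/negP => am; apply: h.
Qed.

Variables (T : finType).
Implicit Types G : sgraph T.

Lemma spectrum_bounded G :
  has_ubound [set a : R | eigenvalue (adjacency R G) a]%classic.
Proof.
have [rs hrs] := poly_roots_seq (monic_neq0 (char_poly_monic (adjacency R G))).
exists (\sum_(x <- rs) `|x|) => a /= ea.
have rsa : a \in rs by apply: hrs; rewrite -eigenvalue_root_char.
rewrite (big_rem a) //= (le_trans (ler_norm a)) // lerDl sumr_ge0 // => x _.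
Qed.

Lemma spectral_radius_ge G a :
  eigenvalue (adjacency R G) a -> a <= spectral_radius R G.
Proof. by move=> ea; apply: ub_le_sup => //; apply: spectrum_bounded. Qed.

(** The spectrum is finite, so its supremum is a maximum; [0 < b] rules out an empty spectrum, whose
    supremum is [0] by convention. *)
Lemma spectral_radius_attained G b : 0 < b -> b <= spectral_radius R G ->
  exists2 a, b <= a & eigenvalue (adjacency R G) a.
Proof.
move=> b0 bG.
have [rs hrs] := poly_roots_seq (monic_neq0 (char_poly_monic (adjacency R G))).
have inrs a : eigenvalue (adjacency R G) a -> a \in rs.
  by move=> ea; apply: hrs; rewrite -eigenvalue_root_char.
have [[a ea]|none] := pselect (exists a, eigenvalue (adjacency R G) a); last first.
  move: bG; rewrite /spectral_radius (_ : [set a | _]%classic = set0) ?sup0.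
    by rewrite leNgt b0.
  by apply/seteqP; split=> // a ea; case: none; exists a.
have [|m [em maxm]] := @seq_max rs (fun a => eigenvalue (adjacency R G) a).
  by exists a => //; apply: inrs.
exists m => //; apply: (le_trans bG); apply: ge_sup; first by exists a.
by move=> c ec; apply: maxm => //; apply: inrs.
Qed.

Lemma mulmx_adjacency G (v : 'rV[R]_#|T|) x :
  (v *m adjacency R G) 0 (enum_rank x) = \sum_(y | G x y) v 0 (enum_rank y).
Proof.
rewrite mxE (reindex enum_rank) /=; last by apply: onW_bij; apply: enum_rank_bij.
rewrite [RHS]big_mkcond /=; apply: eq_bigr => y _.
rewrite mxE !enum_rankK edge_sym.
by case: (G x y); rewrite ?mulr1 ?mulr0.
Qed.

Lemma eigenvalue_of_fun G a (w : T -> R) : (exists x, w x != 0) ->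
    (forall x, \sum_(y | G x y) w y = a * w x) ->
  eigenvalue (adjacency R G) a.
Proof.
move=> [x wx] hw; apply/eigenvalueP; exists (\row_j w (enum_val j)).
  apply/rowP => j; rewrite -[j](enum_valK) mulmx_adjacency !mxE enum_rankK -hw.
  by apply: eq_bigr => y _; rewrite mxE enum_rankK.
apply/eqP => /rowP/(_ (enum_rank x)); rewrite !mxE enum_rankK => /eqP.
by rewrite (negPf wx).
Qed.

(** [w] consists of the absolute values of an eigenvector, and the triangle inequality gives the
    bound. *)
Lemma eigenvalue_subinvariant G a : eigenvalue (adjacency R G) a ->
  exists w : T -> R, [/\ forall x, 0 <= w x, exists x, 0 < w x &
    forall x, a * w x <= \sum_(y | G x y) w y].
Proof.
case/eigenvalueP => v va v0; exists (fun x => `|v 0 (enum_rank x)|); split=> //.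
  have [j vj] : exists j, v 0 j != 0.
    have [//|none] := pselect (exists j, v 0 j != 0); case/eqP: v0.
    apply/rowP => j; rewrite mxE; apply/eqP/negPn/negP => vj.
    by apply: none; exists j.
  by exists (enum_val j); rewrite enum_valK normr_gt0.
move=> x; apply: le_trans (ler_norm_sum _ _ _).
rewrite -mulmx_adjacency va mxE normrM ler_wpM2r //; exact: ler_norm.
Qed.

Lemma sum_edge_exchange G (f g : T -> R) :
  \sum_x f x * \sum_(y | G x y) g y = \sum_y g y * \sum_(x | G y x) f x.
Proof.
under eq_bigr => x _ do rewrite big_distrr /= big_mkcond.
rewrite exchange_big /=; apply: eq_bigr => y _.
rewrite big_distrr [RHS]big_mkcond /=; apply: eq_bigr => x _.
by rewrite edge_sym mulrC.
Qed.

Lemma sum_edge_const G x (c : R) : \sum_(y | G x y) c = (degree G x)%:R * c.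
Proof.
rewrite mulr_natl -sumr_const; apply: eq_bigl => y.
by rewrite inE.
Qed.

(* The Hong-Shu-Fang bound: the row sums of [A ^ 2 - (t - 1) A] are at most
   [2 e - (n - 1) t]. *)
Lemma eigenvalue_degree_bound G (t : nat) a : 0 <= a ->
    (forall x, (t <= degree G x)%N) -> eigenvalue (adjacency R G) a ->
  a * (a - t%:R + 1) + (#|T|%:R - 1) * t%:R <= (\sum_x degree G x)%:R.
Proof.
move=> a0 tdeg /eigenvalue_subinvariant[w [w0 [x0 wx0] hw]].
pose d x : R := (degree G x)%:R; pose W := \sum_x w x.
set E := (\sum_x degree G x)%:R.
have EE : E = \sum_x d x by rewrite /E natr_sum.
have td x : t%:R <= d x by rewrite /d ler_nat.
have W0 : 0 < W.
  by rewrite /W (bigD1 x0) //= ltr_wpDr // sumr_ge0.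
(* The sum is [d x] plus the terms [d u - t] over the neighbours [u]; these terms are nonnegative,
   so all [u != x] may be included. *)
have row x : \sum_(u | G x u) (d u - t%:R + 1) <= E - (#|T|%:R - 1) * t%:R.
  rewrite big_split /= sum_edge_const mulr1 -/(d x).
  have -> : E - (#|T|%:R - 1) * t%:R = \sum_(u | u != x) (d u - t%:R) + d x.
    have : \sum_u (d u - t%:R) = E - #|T|%:R * t%:R.
      by rewrite big_split /= -EE sumr_const mulr_natl mulNrn.
    by rewrite (bigD1 x) //=; lra.
  rewrite lerD2r [leLHS]big_mkcond [leRHS]big_mkcond /=; apply: ler_sum => u _.
  have [->|_] := eqVneq u x; first by rewrite edge_irrefl.
  by case: (G x u); rewrite // subr_ge0.
(* Subinvariance is used twice: with the nonnegative weights [d u - t + 1], and to bound the sum of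
   [d u * w u] from below by [a * W]. *)
have low : a * (a - t%:R + 1) * W <= \sum_x w x * \sum_(u | G x u) (d u - t%:R + 1).
  rewrite sum_edge_exchange.
  have dW : a * W <= \sum_u d u * w u.
    rewrite /W big_distrr /=; apply: (le_trans (ler_sum _ (fun x _ => hw x))).
    have -> : \sum_x \sum_(y | G x y) w y = \sum_u d u * w u; last exact: lexx.
    transitivity (\sum_x 1 * \sum_(y | G x y) w y).
      by apply: eq_bigr => x _; rewrite mul1r.
    rewrite (sum_edge_exchange G (fun=> 1)); apply: eq_bigr => u _.
    by rewrite sum_edge_const mulr1 mulrC.
  apply: (@le_trans _ _ (\sum_u (d u - t%:R + 1) * (a * w u))).
    have -> : \sum_u (d u - t%:R + 1) * (a * w u) = a * (\sum_u d u * w u + (1 - t%:R) * W).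
      rewrite /W big_distrr -big_split big_distrr /=.
      by apply: eq_bigr => u _; ring.
    by rewrite -mulrA ler_wpM2l //; lra.
  apply: ler_sum => u _; rewrite ler_wpM2l //.
  by have := td u; lra.
have high : \sum_x w x * \sum_(u | G x u) (d u - t%:R + 1) <= (E - (#|T|%:R - 1) * t%:R) * W.
  rewrite mulrC /W big_distrl /=; apply: ler_sum => x _.
  by rewrite ler_wpM2l.
have := le_trans low high; rewrite ler_pM2r //; lra.
Qed.

(* Pairing the subinvariant vector of [G] with the Perron vector [y] of [X]. *)
Lemma perron_comparison G (X : rel T) (y : T -> R) (l a : R) :
    subrel G X -> connected G -> (forall x, 0 < y x) ->
    (forall x, \sum_(z | X x z) y z = l * y x) ->
    eigenvalue (adjacency R G) a -> l <= a ->
  X =2 G.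
Proof.
move=> GX [_ connG] y0 hy /eigenvalue_subinvariant[w [w0 [x0 wx0] hw]] la.
(* [B] is at least [a] times and at most [l] times the pairing of [w] with [y]. As [l <= a],
   equality holds throughout; [eq1] and [eq2] read it off vertex by vertex. *)
pose B := \sum_x w x * \sum_(z | G x z) y z.
have leX x : \sum_(z | G x z) y z <= \sum_(z | X x z) y z.
  rewrite [leLHS]big_mkcond [leRHS]big_mkcond /=; apply: ler_sum => z _.
  by case: ifP => [/GX->|_] //; case: ifP => // _; apply: ltW.
have BE : B = \sum_z y z * \sum_(x | G z x) w x by apply: sum_edge_exchange.
have lB : \sum_x w x * \sum_(z | X x z) y z = l * \sum_x w x * y x.
  by rewrite big_distrr /=; apply: eq_bigr => x _; rewrite hy mulrCA.
have wy0 : 0 <= \sum_x w x * y x by apply: sumr_ge0 => x _; rewrite mulr_ge0 // ltW.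
have aB : a * (\sum_x w x * y x) <= B.
  rewrite BE big_distrr /=; apply: ler_sum => z _.
  by rewrite mulrA [leLHS]mulrC ler_wpM2l // ltW.
have Bl : B <= l * \sum_x w x * y x.
  by rewrite -lB; apply: ler_sum => x _; rewrite ler_wpM2l.
have la2 : l * (\sum_x w x * y x) <= a * (\sum_x w x * y x) by rewrite ler_wpM2r.
have eq1 z : \sum_(x | G z x) w x = a * w z.
  pose F u := y u * (\sum_(x | G u x) w x - a * w u).
  have F0 u : 0 <= F u by rewrite mulr_ge0 ?subr_ge0 // ltW.
  have sF : \sum_u F u = 0.
    apply/eqP; rewrite eq_le sumr_ge0 ?andbT // /F.
    under eq_bigr => u _ do rewrite mulrBr.
    rewrite sumrB -BE subr_le0 (le_trans (le_trans Bl la2)) // big_distrr /=.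
    by rewrite le_eqVlt; apply/orP; left; apply/eqP/eq_bigr => u _; ring.
  have /eqP : F z = 0 by apply: (psumr_eq0P (fun u _ => F0 u) sF).
  by rewrite /F mulf_eq0 gt_eqF //= subr_eq0 => /eqP.
have eq2 x : w x * (\sum_(z | X x z) y z - \sum_(z | G x z) y z) = 0.
  pose F x := w x * (\sum_(z | X x z) y z - \sum_(z | G x z) y z).
  have F0 u : 0 <= F u by rewrite mulr_ge0 ?subr_ge0.
  have sF : \sum_u F u = 0.
    apply/eqP; rewrite eq_le sumr_ge0 ?andbT // /F.
    under eq_bigr => u _ do rewrite mulrBr.
    by rewrite sumrB lB -/B subr_le0 (le_trans la2).
  exact: (psumr_eq0P (fun u _ => F0 u) sF).
(* By [eq1] a zero of [w] spreads to all neighbours, so connectedness would carry it to [x0]. *)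
have wpos x : 0 < w x.
  rewrite lt_def w0 andbT; apply/negP => wx.
  have wx0' : ~~ (w x0 == 0) by rewrite gt_eqF.
  have [u [v [/= wu wv uv]]] := connect_exit (A := fun z => w z == 0) (connG x x0) wx wx0'.
  have s0 : \sum_(z | G u z) w z = 0 by rewrite eq1 (eqP wu) mulr0.
  have wv0 : w v = 0 by apply: (psumr_eq0P (fun z _ => w0 z) s0).
  by rewrite wv0 eqxx in wv.
move=> x z; have [Xxz|nX] := boolP (X x z); last first.
  by apply/esym/negbTE; apply: contra nX; apply: GX.
apply/esym; apply: contraT => nG.
have /eqP := eq2 x; rewrite mulf_eq0 gt_eqF //= subr_eq0 => /eqP eqX.
have leG : \sum_(u | G x u) y u <= \sum_(u | X x u && (u != z)) y u.
  rewrite [leLHS]big_mkcond [leRHS]big_mkcond /=; apply: ler_sum => u _.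
  case: ifP => [xu|_]; last by case: ifP => // _; apply: ltW.
  by rewrite GX //; case: eqVneq => // uz; rewrite -uz xu in nG.
by move: eqX leG (y0 z); rewrite (bigD1 z) //=; lra.
Qed.
End Spectrum.

Lemma sum_neq_const (R : realType) (m : nat) (i : 'I_m) (c : R) :
  \sum_(j | i != j) c = (m%:R - 1) * c.
Proof.
have m0 : (0 < m)%N by apply: leq_ltn_trans (ltn_ord i).
have -> : \sum_(j | i != j) c = \sum_(j in predC1 i) c.
  by apply: eq_bigl => j; rewrite !inE eq_sym.
by rewrite sumr_const cardC1 card_ord -[LHS]mulr_natl -subn1 natrB.
Qed.

(* [l] is a root of the characteristic polynomial [p] of the 3 x 3 quotient
   matrix of the join. *)
Lemma join_perron (R : realType) (t m s : nat) : (0 < t)%N -> (0 < m)%N -> (0 < s)%N ->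
  exists (l : R) (y : 'I_t + ('I_m + 'I_s) -> R),
  [/\ t%:R + m%:R - 1 < l, forall x, 0 < y x &
   forall x, \sum_(z | join (complete t) (disjoint_union (complete m) (empty s)) x z) y z
     = l * y x].
Proof.
move=> t0 m0 s0.
have t1 : 1 <= t%:R :> R by rewrite ler1n.
have m1 : 1 <= m%:R :> R by rewrite ler1n.
have s1 : 1 <= s%:R :> R by rewrite ler1n.
move tE: (t%:R : R) => tr in t1 *; move mE: (m%:R : R) => mr in m1 *.
move sE: (s%:R : R) => sr in s1 *.
pose p : {poly R} := ('X - (tr - 1)%:P) * 'X * ('X - (mr - 1)%:P)
   - (mr * tr)%:P * 'X - (sr * tr)%:P * ('X - (mr - 1)%:P).
have pE x : p.[x] = (x - (tr - 1)) * x * (x - (mr - 1)) - mr * tr * x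
    - sr * tr * (x - (mr - 1)).
  by rewrite /p !hornerE.
(* [l0] is the spectral radius of the complete graph on [t + m] vertices; [p] is negative there and
   nonnegative at [l0 + q]. *)
pose l0 := tr + mr - 1; pose q := sr * tr.
have q1 : 1 <= q by rewrite /q; nra.
have p0 : p.[l0] < 0.
  have -> : p.[l0] = - (sr * tr * tr) by rewrite pE /l0; ring.
  by rewrite oppr_lt0 !mulr_gt0 //; lra.
have p1 : 0 <= p.[l0 + q].
  have -> : p.[l0 + q] = (l0 + q) * mr * q + (l0 + q - 1) * q * (tr + q).
    by rewrite pE /l0 /q; ring.
  by rewrite addr_ge0 // !mulr_ge0 //; rewrite /l0; lra.
have le01 : l0 <= l0 + q by rewrite lerDl; lra.
have sgn : p.[l0] <= 0 <= p.[l0 + q] by rewrite (ltW p0) p1.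
have [l /andP[l0l _] /rootP pl] := poly_ivt le01 sgn.
have ll : l0 < l.
  by rewrite lt_def l0l andbT; apply: contraTneq p0 => <-; rewrite pl ltxx.
(* The equations on the last two parts, with denominators cleared, determine [y]; the one on the
   first part then says that [l] is a root of [p]. *)
pose y (z : 'I_t + ('I_m + 'I_s)) : R :=
  match z with
  | inl _ => l * (l - (mr - 1))
  | inr (inl _) => tr * l
  | inr (inr _) => tr * (l - (mr - 1))
  end.
rewrite pE in pl; rewrite /l0 in ll.
exists l, y; split=> //.
  by case=> [i|[i|i]] /=; rewrite mulr_gt0 //; lra.
case=> [i|[i|i]]; rewrite !big_sumType /=.
- rewrite sum_neq_const !sumr_const !card_ord -[_ *+ m]mulr_natl -[_ *+ s]mulr_natl tE mE sE.
  by apply/eqP; rewrite -subr_eq0; apply/eqP; rewrite -[RHS]oppr0 -pl; ring.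
- rewrite /complete_rel sum_neq_const sumr_const card_ord -[_ *+ t]mulr_natl tE mE.
  by rewrite big_pred0 //; ring.
rewrite sumr_const card_ord -[_ *+ t]mulr_natl tE.
by rewrite !big_pred0 //; ring.
Qed.

(** * From the spectral hypothesis to a long path or the extremal graph *)

Theorem theorem1p7 (R : realType) (k t n : nat) (T : finType) (G : sgraph T)
    (hk : (2 <= k)%N) (ht : (1 <= t)%N)
    (hG : t_connected t G) (hcard : #|T| = n)
    (hn : Num.max (6 * k%:R + 6 * t%:R - 1)
            (k%:R ^+ 2 + 3 / 2 * k%:R * t%:R + 1 / 2 * t%:R ^+ 2
               + 1 / 2 * t%:R + 1) <= n%:R :> R)
    (hrho : spectral_radius R (extremal n k t) <= spectral_radius R G) :
  ~ isomorphic G (extremal n k t) -> has_spanning_ended_tree k G.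
Proof.
move=> notiso; have connG := t_connected_connected ht hG.
have n6 : (6 * k + 6 * t <= n + 1)%N.
  have : 6 * k%:R + 6 * t%:R - 1 <= n%:R :> R by apply: le_trans hn; rewrite le_max lexx.
  by rewrite -(ler_nat R); lra.
have n2 : (2 * k ^ 2 + 3 * (k * t) + t ^ 2 + t + 2 <= 2 * n)%N.
  have : k%:R ^+ 2 + 3 / 2 * k%:R * t%:R + 1 / 2 * t%:R ^+ 2
               + 1 / 2 * t%:R + 1 <= n%:R :> R by apply: le_trans hn; rewrite le_max lexx orbT.
  by rewrite -(ler_nat R); lra.
pose s := (k + t - 1)%N; pose m := (n + 1 - (k + 2 * t))%N.
have nE : n = (t + (m + s))%N by rewrite /m /s; lia.
have m0 : (0 < m)%N by rewrite /m; lia.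
have s0 : (0 < s)%N by rewrite /s; lia.
have [l [y [l0 y0 hy]]] := join_perron R ht m0 s0.
have [t1 m1] : 1 <= t%:R :> R /\ 1 <= m%:R :> R by rewrite !ler1n.
have ext_eig : eigenvalue (adjacency R (extremal n k t)) l.
  apply: eigenvalue_of_fun hy; exists (inl (Ordinal ht)).
  by rewrite gt_eqF.
have [|a la ea] := spectral_radius_attained _ (le_trans (spectral_radius_ge ext_eig) hrho).
  by lra.
(* This is the edge condition for the cone, which has [n + 1] vertices, connectivity [t + 1] and a
   degree sum larger by [2 * n]. *)
have hE : ((m + t + 1) * (m + t) + (t + 2) * s < \sum_x degree G x + 2 * n)%N.
  have a0 : 0 <= a by lra.
  have := eigenvalue_degree_bound a0 (fun x => t_connected_degree x hG) ea.
  rewrite hcard -(ltr_nat R) => bnd.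
  have aL : (t%:R + m%:R - 1) * m%:R < a * (a - t%:R + 1) :> R.
    by apply: ltr_pM => //; lra.
  have nR : n%:R = t%:R + m%:R + s%:R :> R by rewrite nE !natrD addrA.
  move: aL bnd; rewrite nR; set A := a * _; rewrite !(natrD, natrM, nR).
  by lra.
(* As [s = k + t - 1], such a cycle has at least [n - k + 3] vertices and yields a path on at least
   [n - k + 2], so all but at most [k] vertices are inner. *)
have [[Z ucZ szZ]|short] := pselect (exists2 Z,
    ucycle (cone G) Z & (n + 2 + t <= size Z + s)%N).
  have [|x [p [path_p up szp]]] := cone_cycle_path ucZ; first by rewrite /s in szZ; lia.
  by apply: path_spanning_tree path_p up _ => //; rewrite hcard; rewrite /s in szZ; lia.
have cardV : #|{: option T}| = n.+1 by rewrite card_option hcard.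
have [|||||||S [D [cS cD dSD nbrD]]] :=
  @long_cycle_or_independent _ (cone G) s t.+1.
- by lia.
- by rewrite /s; lia.
- by rewrite cardV /s; lia.
- by rewrite cardV; apply: order_bound_arith => //; lia.
- exact: sep_connected_cone.
- rewrite cardV sum_degree_cone hcard.
  have -> : (n.+1 - s = m + t + 1)%N by lia.
  have -> : (m + t + 1 - 1 = m + t)%N by lia.
  by lia.
- move=> Z ucZ; rewrite cardV ltnNge; apply/negP => szZ; apply: short.
  by exists Z => //; lia.
case: notiso.
pose S' := [set x | Some x \in S]; pose D' := [set x | Some x \in D].
(* In [D], the apex would force all [n] other vertices into [S]. So it lies in [S], being adjacent
   to [D], and [t] vertices of [S] remain in [G]. *)
have apexD : None \notin D.
  apply/negP => D0; have : [set: option T] :\ None \subset S.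
    apply/fintype.subsetP => -[x|]; rewrite !inE //= => _.
    exact: (nbrD None).
  move/subset_leq_card; rewrite cS; have := cardsD1 None [set: option T].
  by rewrite cardsT cardV inE add1n => -[<-]; lia.
have apexS : None \in S.
  have : (0 < #|D|)%N by rewrite cD.
  case/card_gt0P => -[x|] Dx; last by rewrite Dx in apexD.
  exact: nbrD Dx _.
have cS' : #|S'| = t.
  rewrite (cardsD1 None) apexS add1n in cS; move: cS => [<-].
  have inj : injective (@Some T) by move=> u v [].
  rewrite -(card_imset _ inj); apply: eq_card => -[x|]; rewrite !inE /=.
    by apply/imsetP/idP => [[z]|Sx]; [rewrite inE => Sz [->] | exists x; rewrite ?inE].
  by apply/imsetP => -[].
have cD' : #|D'| = s.
  rewrite -cD; have inj : injective (@Some T) by move=> u v [].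
  rewrite -(card_imset _ inj); apply: eq_card => -[x|].
    by apply/imsetP/idP => [[z]|Sx]; [rewrite inE => Sz [->] | exists x; rewrite ?inE].
  by rewrite (negPf apexD); apply/imsetP => -[].
have dSD' : [disjoint S' & D'].
  by apply/pred0P => x; rewrite /= !inE; have /pred0P/(_ (Some x)) := dSD.
have nbrD' x z : x \in D' -> G x z -> z \in S'.
  by rewrite !inE => Dx xz; apply: nbrD Dx _.
have cT : #|T| = (t + (m + s))%N by rewrite hcard.
have [f bijf Gf] := join_embedding cT cS' cD' dSD' nbrD'.
exists f => //.
(* The extremal graph pulled back along [f] contains [G] and has a positive eigenvector for
   [l <= a], so it equals [G]. *)
pose X : rel T := fun x z => extremal n k t (f x) (f z).
apply: (perron_comparison (X := X) (y := y \o f) (l := l) (a := a)) => //.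
- by move=> x /=.
move=> x /=; rewrite -hy (reindex f) //=.
exact: onW_bij.
Qed.
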